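(* Let $p>3$ be a prime. When passing from $\mathcal{G}_2(\mathbb{F}_p)$ to the spine $\mathcal{S}\subset\mathcal{G}_2(\overline{\mathbb{F}}_p)$, only stacking, folding, or at most one attachment by a new edge are possible. That is: every connected component of $\mathcal{G}_2(\mathbb{F}_p)$ either stacks with another component or folds, and there is at most one unordered pair $\{a,b\}$ of $j$-invariants in $\mathbb{F}_p$ for which components are attached by a new edge $[a,b]$. In particular, no two components attach along a $j$-invariant.
   Context: Let $p>3$ and $\ell\neq p$ be primes (here $\ell=2$), and let $\Phi_\ell(X,Y)\in\mathbb{Z}[X,Y]$ be the classical $\ell$-th modular polynomial. $\mathcal{G}_\ell(\overline{\mathbb{F}}_p)$: vertices are $\overline{\mathbb{F}}_p$-isomorphism classes of supersingular elliptic curves, labelled by their $j$-invariants (which lie in $\mathbb{F}_{p^2}$); the edges from $j$ are the pairs $(j,j')$ with $j'$ a root of $\Phi_\ell(j,Y)$, counted with multiplicity. The spine $\mathcal{S}$ is the full subgraph on the vertices with $j\in\mathbb{F}_p$. $\mathcal{G}_\ell(\mathbb{F}_p)$: vertices are $\mathbb{F}_p$-isomorphism classes of supersingular elliptic curves over $\mathbb{F}_p$; edges are $\ell$-isogenies defined over $\mathbb{F}_p$, up to $\mathbb{F}_p$-isomorphism, taken as undirected by identifying an isogeny with its dual. Every supersingular $a\in\mathbb{F}_p$ is the $j$-invariant of exactly two vertices, denoted $v_a,w_a$; for $a\ne1728$ they are quadratic twists of each other. Passing from $\mathcal{G}_\ell(\mathbb{F}_p)$ to $\mathcal{S}$: first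 identify vertices with the same $j$-invariant (and equivalent edges), then add the edges of $\mathcal{G}_\ell(\overline{\mathbb{F}}_p)$ between vertices in $\mathbb{F}_p$ that are not defined over $\mathbb{F}_p$. Two distinct components $V,W$ of $\mathcal{G}_\ell(\mathbb{F}_p)$ stack if, after relabelling each vertex by its $j$-invariant, they become isomorphic as (labelled) graphs. A component $V$ folds if it contains the vertices corresponding to both quadratic twists of every $j$-invariant on $V$, i.e. for every vertex $E$ of $V$ the vertex of the quadratic twist $E^t$ is in $V$ (when $p\equiv3\pmod 4$, a curve with $j=1728$ is $\mathbb{F}_p$-isomorphic to its quadratic twist). A new edge is an edge $[a,b]$ of $\mathcal{S}$, $a\neq b$, such that no edge of $\mathcal{G}_\ell(\mathbb{F}_p)$ joins a vertex with $j$-invariant $a$ to a vertex with $j$-invariant $b$. Components $V,W$ of $\mathcal{G}_\ell(\mathbb{F}_p)$ are attached by a new edge if there is a new edge $[a,b]$ corresponding to an isogeny, not defined over $\mathbb{F}_p$, between a vertex $v_a\in V$ and a vertex $w_b\in W$. Two distinct components $V,W$ attach along the $j$-invariant $a$ if $v_a\in V$, $w_a\in W$ for the two vertices with $j$-invariant $a$, some neighbour of $v_a$ has a $j$-invariant that is not the $j$-invariant of any neighbour of $w_a$, and vice versa. *)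

(* Defs.v *)
From HB Require Import structures.
From Stdlib Require Export Relation_Operators.
From mathcomp Require Export all_boot all_order all_algebra.
From mathcomp Require Export boolp classical_sets functions.

Set Implicit Arguments.
Unset Strict Implicit.
Unset Printing Implicit Defensive.

Import GRing.Theory.
Local Open Scope classical_set_scope.
Local Open Scope ring_scope.

(** * Quotients *)

(* The quotient of T by an equivalence relation R; an element is a class. *)
Record quotient (T : Type) (R : T -> T -> Prop) := Quotient {
  members : set T;
  membersP : exists x, members = [set y | R x y] }.

Definition class (T : Type) (R : T -> T -> Prop) (x : T) : quotient R :=
  Quotient (ex_intro _ x erefl).

(** * Elliptic curves in characteristic different from 2 and 3 *)

(* The curve y^2 = x^3 + A x + B. *)
Record curve (k : fieldType) := Curve {
  coefA : k;
  coefB : k;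
  curve_nonsingular : 4 * coefA ^+ 3 + 27 * coefB ^+ 2 != 0 }.

Definition jinv (k : fieldType) (E : curve k) : k :=
  1728 * (4 * coefA E ^+ 3) / (4 * coefA E ^+ 3 + 27 * coefB E ^+ 2).

Definition cubic (k : fieldType) (E : curve k) : {poly k} :=
  'X^3 + coefA E *: 'X + (coefB E)%:P.

Lemma map_curve_subproof (k K : fieldType) (f : {rmorphism k -> K})
    (E : curve k) : 4 * f (coefA E) ^+ 3 + 27 * f (coefB E) ^+ 2 != 0.
Proof.
suff <- : f (4 * coefA E ^+ 3 + 27 * coefB E ^+ 2) =
    4 * f (coefA E) ^+ 3 + 27 * f (coefB E) ^+ 2.
  by rewrite fmorph_eq0 curve_nonsingular.
by rewrite rmorphD 2?[f (_%:R * _)]rmorphM !rmorphXn !rmorph_nat.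
Qed.

Definition map_curve (k K : fieldType) (f : {rmorphism k -> K})
    (E : curve k) : curve K := Curve (map_curve_subproof f E).

(* None is the point at infinity O. *)
Definition point (k : fieldType) : Type := option (k * k).

Definition on_curve (k : fieldType) (E : curve k) (P : point k) : bool :=
  if P is Some (x, y) then y ^+ 2 == x ^+ 3 + coefA E * x + coefB E else true.

(* Chord-and-tangent addition; meaningful for P and Q on E. *)
Definition addP (k : fieldType) (E : curve k) (P Q : point k) : point k :=
  match P, Q with
  | None, _ => Q
  | _, None => P
  | Some (x1, y1), Some (x2, y2) =>
      let chord l :=
        let x3 := l ^+ 2 - x1 - x2 in Some (x3, l * (x1 - x3) - y1) in
      if x1 != x2 then chord ((y2 - y1) / (x2 - x1))
      else if y1 == - y2 then None
      else chord ((3 * x1 ^+ 2 + coefA E) / (2 * y1))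
  end.

(* Over an algebraically closed field K of characteristic p: E[p] = O. *)
Definition supersingular (p : nat) (K : closedFieldType) (E : curve K) : Prop :=
  forall P, on_curve E P -> iter p (addP E P) None = None -> P = None.

(* The isomorphism (x, y) |-> (w^2 x, w^3 y). *)
Definition scale_iso (k : fieldType) (w : k) (E E' : curve k) : Prop :=
  [/\ w != 0, coefA E' = w ^+ 4 * coefA E & coefB E' = w ^+ 6 * coefB E].

Definition scale_point (k : fieldType) (w : k) (P : point k) : point k :=
  if P is Some (x, y) then Some (w ^+ 2 * x, w ^+ 3 * y) else None.

(* E' is the twist d y^2 = x^3 + A x + B of E by a nonsquare d. *)
Definition quadratic_twist (k : fieldType) (E E' : curve k) : Prop :=
  exists d : k, [/\ ~ exists c, c ^+ 2 = d,
    coefA E' = d ^+ 2 * coefA E & coefB E' = d ^+ 3 * coefB E].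

(** * Isogenies *)

(* The rational map (x, y) |-> (xnum / xden, y * (ynum / yden)). *)
Record xymap (k : fieldType) := XYMap {
  xnum : {poly k}; xden : {poly k};
  ynum : {poly k}; yden : {poly k} }.

Definition reduced (k : fieldType) (phi : xymap k) : Prop :=
  [/\ xden phi \is monic, yden phi \is monic,
      coprimep (xnum phi) (xden phi) & coprimep (ynum phi) (yden phi)].

(* Since phi \o [-1] = [-1] \o phi, every isogeny from E to E' is given by an
   xymap, unique once reduced.  The degree inequality says that O is sent to O
   (so that phi is nonconstant); the identity says that the image lies on E'. *)
Definition isogeny (k : fieldType) (E E' : curve k) (phi : xymap k) : Prop :=
  [/\ reduced phi,
      (size (xden phi) < size (xnum phi))%N &
      xden phi ^+ 3 * ynum phi ^+ 2 * cubic E =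
      yden phi ^+ 2 * (xnum phi ^+ 3
                       + coefA E' *: (xnum phi * xden phi ^+ 2)
                       + coefB E' *: xden phi ^+ 3)].

(* The degree of an isogeny is the larger of deg xnum and deg xden. *)
Definition isog_deg (k : fieldType) (phi : xymap k) : nat := (size (xnum phi)).-1.

Definition map_xymap (k K : fieldType) (f : {rmorphism k -> K})
    (phi : xymap k) : xymap K :=
  XYMap (map_poly f (xnum phi)) (map_poly f (xden phi))
        (map_poly f (ynum phi)) (map_poly f (yden phi)).

(* For an isogeny of E, yden does not vanish at the abscissa of a point of E
   at which xden does not vanish. *)
Definition eval_xymap (k : fieldType) (phi : xymap k) (P : point k) : point k :=
  if P is Some (x, y) then
    if (xden phi).[x] == 0 then None
    else Some ((xnum phi).[x] / (xden phi).[x],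
               y * ((ynum phi).[x] / (yden phi).[x]))
  else None.

(** * The graph over the algebraic closure, for l = 2 *)

(* The classical modular polynomial Phi_2; its coefficients are
   162000 = 2^4 3^4 5^3, 40773375 = 3^4 5^3 4027,
   8748000000 = 2^8 3^7 5^6 and 157464000000000 = 2^12 3^9 5^9. *)
Definition Phi2 (R : comNzRingType) (X Y : R) : R :=
  X ^+ 3 + Y ^+ 3 - X ^+ 2 * Y ^+ 2
  + 1488 * (X ^+ 2 * Y + X * Y ^+ 2)
  - 2 ^+ 4 * 3 ^+ 4 * 5 ^+ 3 * (X ^+ 2 + Y ^+ 2)
  + 3 ^+ 4 * 5 ^+ 3 * 4027 * (X * Y)
  + 2 ^+ 8 * 3 ^+ 7 * 5 ^+ 6 * (X + Y)
  - 2 ^+ 12 * 3 ^+ 9 * 5 ^+ 9.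

Definition supersingular_j (p : nat) (K : closedFieldType) (x : K) : Prop :=
  exists2 E : curve K, supersingular p E & jinv E = x.

(* The number of edges from x to y. *)
Definition edge_mult (K : closedFieldType) (x y : K) : nat :=
  mup y (Phi2 x%:P 'X).

(** * The graph over the prime field and the spine, for l = 2 *)

Section Graphs.

(* F is the prime field of order p and iota its embedding into an algebraic
   closure K. *)
Variables (p : nat) (F : fieldType) (K : closedFieldType).
Variable iota : {rmorphism F -> K}.

Record ss_curve := SSCurve {
  ss_val :> curve F;
  ss_valP : supersingular p (map_curve iota ss_val) }.

Definition ss_iso (E E' : ss_curve) : Prop := exists w : F, scale_iso w E E'.

Definition vertex : Type := quotient ss_iso.

Definition vertex_of (E : ss_curve) : vertex := class ss_iso E.

Definition vertex_j (v : vertex) : F :=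
  xget 0 [set jinv (ss_val E) | E in members v].

Record isogeny2 := Isogeny2 {
  isog_src : ss_curve;
  isog_tgt : ss_curve;
  isog_map : xymap F;
  isog_mapP : isogeny isog_src isog_tgt isog_map;
  isog_map_deg : isog_deg isog_map = 2%N }.

Definition isog_eval (phi : isogeny2) : point K -> point K :=
  eval_xymap (map_xymap iota (isog_map phi)).

Definition isog_iso (phi psi : isogeny2) : Prop :=
  exists w z : F,
  [/\ scale_iso w (isog_src phi) (isog_src psi),
      scale_iso z (isog_tgt phi) (isog_tgt psi) &
      forall P, on_curve (map_curve iota (isog_src phi)) P ->
        isog_eval psi (scale_point (iota w) P) =
        scale_point (iota z) (isog_eval phi P)].

(* psi \o phi = [2]. *)
Definition isog_dual (phi psi : isogeny2) : Prop :=
  [/\ isog_src psi = isog_tgt phi, isog_tgt psi = isog_src phi &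
      forall P, on_curve (map_curve iota (isog_src phi)) P ->
        isog_eval psi (isog_eval phi P) =
        addP (map_curve iota (isog_src phi)) P P].

Definition isog_equiv : isogeny2 -> isogeny2 -> Prop :=
  clos_refl_sym_trans isogeny2
    (fun phi psi => isog_iso phi psi \/ isog_dual phi psi).

Definition edge : Type := quotient isog_equiv.

Definition joins (e : edge) (v w : vertex) : Prop :=
  exists2 phi : isogeny2, members e phi &
    (members v (isog_src phi) /\ members w (isog_tgt phi)) \/
    (members w (isog_src phi) /\ members v (isog_tgt phi)).

Definition adjacent (v w : vertex) : Prop := exists e : edge, joins e v w.

Definition component (V : set vertex) : Prop :=
  exists v, V = [set w | clos_refl_trans vertex adjacent v w].

Definition edges_in (V : set vertex) : set edge :=
  [set e | exists v w, [/\ V v, V w & joins e v w]].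

Definition stack (V W : set vertex) : Prop :=
  V <> W /\
  exists (f : vertex -> vertex) (g : edge -> edge),
  [/\ set_bij V W f,
      forall v, V v -> vertex_j (f v) = vertex_j v,
      set_bij (edges_in V) (edges_in W) g &
      forall e v w, edges_in V e -> V v -> V w ->
        joins e v w <-> joins (g e) (f v) (f w)].

Definition folds (V : set vertex) : Prop :=
  forall E E' : ss_curve,
    V (vertex_of E) -> quadratic_twist E E' -> V (vertex_of E').

Definition spine_edge (a b : F) : Prop :=
  [/\ supersingular_j p (iota a), supersingular_j p (iota b) &
      (0 < edge_mult (iota a) (iota b))%N].

Definition new_edge (a b : F) : Prop :=
  [/\ a <> b, spine_edge a b &
      ~ exists v w, [/\ vertex_j v = a, vertex_j w = b & adjacent v w]].

Definition attached_by_new_edge (V W : set vertex) (a b : F) : Prop :=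
  new_edge a b /\
  exists (E E' : ss_curve) (phi : xymap K),
  [/\ V (vertex_of E) /\ jinv E = a, W (vertex_of E') /\ jinv E' = b,
      isogeny (map_curve iota E) (map_curve iota E') phi /\ isog_deg phi = 2%N &
      ~ exists phi0 : xymap F, phi = map_xymap iota phi0].

Definition new_neighbour_j (v w : vertex) : Prop :=
  exists2 x, adjacent v x &
    forall y, adjacent w y -> vertex_j y <> vertex_j x.

Definition attach_along (V W : set vertex) (a : F) : Prop :=
  V <> W /\
  exists v w, [/\ V v /\ vertex_j v = a, W w /\ vertex_j w = a,
                  new_neighbour_j v w & new_neighbour_j w v].

End Graphs.

(* Main.v *)
From mathcomp Require Import all_fingroup cyclic finfield ring.
Require Import Defs.

(** Twisting by a fixed nonsquare is an automorphism of the graph over F_p which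
    preserves j.  It maps a component either to itself, which then folds, or to
    another component, with which it stacks.  Two vertices with the same j, other
    than 0 and 1728, are equal or twists of each other, so their neighbours have
    the same j-invariants; at j = 0 all neighbours have j = 54000, and at j = 1728
    the neighbour given by the kernel (0, 0) has j = 1728 and the others have
    j = 287496.

    An isogeny of degree 2 is, up to scaling, Velu's quotient by a point (e, 0).
    If [a, b] is a new edge then e is not rational, so the Frobenius conjugate of
    e gives a second edge from a to b.  Equality of the j-invariants of the two
    quotients factors: a = 0 and a = 1728 lead to an edge which is also defined
    over F_p, a = -3375 gives b = a, and in the last case a and b are the two
    roots of the Hilbert class polynomial X^2 + 191025 X - 495^3 of discriminant
    -15. *)

Set Implicit Arguments.
Unset Strict Implicit.
Unset Printing Implicit Defensive.

Import GRing.Theory.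
Local Open Scope classical_set_scope.
Local Open Scope ring_scope.

(* E' is Velu's model of the quotient of E by the point (e, 0). *)
Definition quot_by (k : fieldType) (E : curve k) (e : k) (E' : curve k) : Prop :=
  [/\ e ^+ 3 + coefA E * e + coefB E = 0,
      coefA E' = - (4 * coefA E + 15 * e ^+ 2) &
      coefB E' = - (22 * e ^+ 3 + 8 * coefA E * e)].

(** * Scaling isomorphisms and quotients by a point of order 2 *)

Section Field.
Variable k : fieldType.
Implicit Types (E : curve k) (w e : k).

Lemma curve_eq E E' : coefA E = coefA E' -> coefB E = coefB E' -> E = E'.
Proof.
case: E E' => A B h [A' B' h'] /= eA eB.
by move: h'; rewrite -eA -eB => h'; rewrite (bool_irrelevance h h').
Qed.

Lemma scale_iso_refl E : scale_iso 1 E E.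
Proof. by split; rewrite ?expr1n ?mul1r ?oner_eq0. Qed.

Lemma scale_iso_sym w E E' : scale_iso w E E' -> scale_iso w^-1 E' E.
Proof.
by case=> w0 a b; split; rewrite ?invr_eq0 // ?a ?b; field; exact: w0.
Qed.

Lemma scale_iso_trans w z E E' E'' :
  scale_iso w E E' -> scale_iso z E' E'' -> scale_iso (z * w) E E''.
Proof.
by case=> w0 a b [z0 a' b']; split; rewrite ?mulf_neq0 // ?a' ?b' ?a ?b; ring.
Qed.

Lemma jinv_scale w E E' : scale_iso w E E' -> jinv E' = jinv E.
Proof.
case=> w0 eA eB; rewrite /jinv eA eB.
have -> : 4 * (w ^+ 4 * coefA E) ^+ 3 + 27 * (w ^+ 6 * coefB E) ^+ 2 =
  w ^+ 12 * (4 * coefA E ^+ 3 + 27 * coefB E ^+ 2) by ring.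
have -> : 1728 * (4 * (w ^+ 4 * coefA E) ^+ 3) =
  w ^+ 12 * (1728 * (4 * coefA E ^+ 3)) by ring.
by rewrite -mulf_div divff ?mul1r // expf_neq0.
Qed.

Lemma scale_pointM w z (P : point k) :
  scale_point (w * z) P = scale_point w (scale_point z P).
Proof. by case: P => [[x y]|] //=; congr (Some (_, _)); ring. Qed.

Lemma scale_point1 (P : point k) : scale_point 1 P = P.
Proof. by case: P => [[x y]|] //=; rewrite !expr1n !mul1r. Qed.

Lemma scale_pointC w z (P : point k) :
  scale_point w (scale_point z P) = scale_point z (scale_point w P).
Proof. by rewrite -!scale_pointM mulrC. Qed.

Lemma scale_pointK w (P : point k) : w != 0 ->
  scale_point w (scale_point w^-1 P) = P.
Proof. by move=> w0; rewrite -scale_pointM divff ?scale_point1. Qed.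

Lemma on_curve_scale w E E' P : scale_iso w E E' ->
  on_curve E' (scale_point w P) = on_curve E P.
Proof.
case=> w0 eA eB; case: P => [[x y]|] //=; rewrite eA eB.
have w6 : w ^+ 6 != 0 by rewrite expf_neq0.
rewrite -[RHS](inj_eq (mulfI w6)); congr (_ == _); ring.
Qed.

Lemma addP_scale w E E' P Q : scale_iso w E E' ->
  addP E' (scale_point w P) (scale_point w Q) = scale_point w (addP E P Q).
Proof.
case=> w0 eA eB; case: P Q => [[x1 y1]|] [[x2 y2]|] //=.
have w2 : w ^+ 2 != 0 by rewrite expf_neq0.
have w3 : w ^+ 3 != 0 by rewrite expf_neq0.
rewrite (inj_eq (mulfI w2)) -[- (w ^+ 3 * y2)]mulrN (inj_eq (mulfI w3)).
case: eqP => /= [ex|/eqP nx].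
  case: eqP => //= _.
  have -> : (3 * (w ^+ 2 * x1) ^+ 2 + coefA E') / (2 * (w ^+ 3 * y1)) =
    w * ((3 * x1 ^+ 2 + coefA E) / (2 * y1)).
    have -> : 3 * (w ^+ 2 * x1) ^+ 2 + coefA E' =
      w ^+ 4 * (3 * x1 ^+ 2 + coefA E) by rewrite eA; ring.
    by rewrite [2 * _]mulrCA -mulf_div exprS mulfK.
  congr (Some (_, _)); ring.
have -> : (w ^+ 3 * y2 - w ^+ 3 * y1) / (w ^+ 2 * x2 - w ^+ 2 * x1) =
   w * ((y2 - y1) / (x2 - x1)).
  by field; rewrite -mulrBr mulf_neq0 //= ?w0 subr_eq0 eq_sym nx.
congr (Some (_, _)); ring.
Qed.

Hypotheses (k2 : (2 : k) != 0) (k3 : (3 : k) != 0).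

(** Constants such as [1728 * 27] are products of powers of 2 and 3, so they are invertible as soon
    as 2 and 3 are. *)
Lemma natr23_neq0 m n : ((2 ^ m * 3 ^ n)%N%:R : k) != 0.
Proof. by rewrite natrM !natrX mulf_neq0 ?expf_neq0. Qed.

Lemma jinv_eq0 E : (jinv E == 0) = (coefA E == 0).
Proof.
rewrite /jinv mulf_eq0 invr_eq0 (negPf (curve_nonsingular E)) orbF.
by rewrite mulrA -natrM mulf_eq0 expf_eq0 (negPf (natr23_neq0 8 3)).
Qed.

Lemma jinv_eq1728 E : (jinv E == 1728) = (coefB E == 0).
Proof.
have h := curve_nonsingular E.
rewrite /jinv -subr_eq0.
have -> : 1728 * (4 * coefA E ^+ 3) / (4 * coefA E ^+ 3 + 27 * coefB E ^+ 2) - 1728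
  = - 1728 * 27 * coefB E ^+ 2 / (4 * coefA E ^+ 3 + 27 * coefB E ^+ 2).
  by field.
rewrite mulf_eq0 invr_eq0 (negPf h) orbF mulf_eq0 expf_eq0 /= mulNr -natrM.
by rewrite oppr_eq0 (negPf (natr23_neq0 6 6)).
Qed.

(** The discriminant [4 A^3 + 27 B^2] equals [f'(e)^2 (3 e^2 + 4 A)], where [f] is the cubic and
    [- (3 e^2 + 4 A)] is the discriminant of the quadratic [f / (X - e)]. *)
Lemma root_disc E e : e ^+ 3 + coefA E * e + coefB E = 0 ->
  3 * e ^+ 2 + coefA E != 0 /\ 3 * e ^+ 2 + 4 * coefA E != 0.
Proof.
move=> r; have := curve_nonsingular E.
have -> : coefB E = - (e ^+ 3 + coefA E * e).
  by apply/eqP; rewrite -addr_eq0 addrC r.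
have -> : 4 * coefA E ^+ 3 + 27 * (- (e ^+ 3 + coefA E * e)) ^+ 2 =
  (3 * e ^+ 2 + coefA E) ^+ 2 * (3 * e ^+ 2 + 4 * coefA E) by ring.
by rewrite mulf_eq0 expf_eq0 /= negb_or => /andP[].
Qed.

Lemma quot_exists E e : e ^+ 3 + coefA E * e + coefB E = 0 ->
  exists E', quot_by E e E'.
Proof.
move=> r; have [t0 d0] := root_disc r.
have h : 4 * (- (4 * coefA E + 15 * e ^+ 2)) ^+ 3
   + 27 * (- (22 * e ^+ 3 + 8 * coefA E * e)) ^+ 2 != 0.
  (* In the quotient the two factors of [root_disc] exchange roles: the one that was simple is now
     squared. *)
  have -> : 4 * (- (4 * coefA E + 15 * e ^+ 2)) ^+ 3
     + 27 * (- (22 * e ^+ 3 + 8 * coefA E * e)) ^+ 2 =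
    - (2 ^+ 4 * (3 * e ^+ 2 + 4 * coefA E) ^+ 2 * (3 * e ^+ 2 + coefA E)) by ring.
  by rewrite oppr_eq0 !mulf_neq0 ?expf_neq0.
by exists (Curve h).
Qed.

Lemma quot_unique E e E' E'' : quot_by E e E' -> quot_by E e E'' -> E' = E''.
Proof. by case=> _ a b [_ a' b']; apply: curve_eq; rewrite ?a ?a' ?b ?b'. Qed.

Lemma quot_scale w E E1 e E2 : scale_iso w E E1 -> quot_by E e E2 ->
  exists2 E3, quot_by E1 (w ^+ 2 * e) E3 & scale_iso w E2 E3.
Proof.
move=> [w0 a b] [r a2 b2].
have [|E3 q3] := @quot_exists E1 (w ^+ 2 * e).
  rewrite a b; have -> : (w ^+ 2 * e) ^+ 3 + w ^+ 4 * coefA E * (w ^+ 2 * e)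
    + w ^+ 6 * coefB E = w ^+ 6 * (e ^+ 3 + coefA E * e + coefB E) by ring.
  by rewrite r mulr0.
exists E3 => //; case: q3 => _ a3 b3.
by split=> //; rewrite ?a3 ?b3 ?a2 ?b2 ?a; ring.
Qed.

(** The other two points of order 2 both map to the point of abscissa [- 2 e], which generates the
    kernel of the dual. Both maps preserve the invariant differential while doubling multiplies it
    by 2, whence the scale factor 2. *)
Lemma quot_dual E e E' : quot_by E e E' ->
  exists2 E'', quot_by E' (- (2 * e)) E'' & scale_iso 2 E E''.
Proof.
move=> [r a b].
have eB : coefB E = - (e ^+ 3 + coefA E * e).
  by apply/eqP; rewrite -addr_eq0 addrC r.
have [|E3 q3] := @quot_exists E' (- (2 * e)); first by rewrite a b; ring.
exists E3 => //; case: q3 => _ a3 b3.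
by split=> //; rewrite ?a3 ?b3 ?a ?b ?eB; ring.
Qed.

(* Velu: the abscissa is x + (3 e^2 + A) / (x - e). *)
Lemma quot_isogeny E e E' : quot_by E e E' ->
  exists2 phi, isogeny E E' phi & isog_deg phi = 2%N.
Proof.
move=> [r a b]; have [t0 d0] := root_disc r.
have eB : coefB E = - (e ^+ 3 + coefA E * e).
  by apply/eqP; rewrite -addr_eq0 addrC r.
set t := 3 * e ^+ 2 + coefA E in t0 *.
pose N : {poly k} := 'X ^+ 2 + (t%:P - e%:P * 'X).
pose D : {poly k} := 'X - e%:P.
have sN : size N = 3%N.
  rewrite /N size_polyDl size_polyXn //.
  apply: leq_ltn_trans (size_polyD _ _) _; rewrite size_polyN gtn_max.
  rewrite (leq_ltn_trans (size_polyC_leq1 _)) //=.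
  by rewrite mul_polyC (leq_ltn_trans (size_scale_leq _ _)) // size_polyX.
(* The ordinate is multiplied by the derivative [1 - t / (x - e)^2] of the abscissa. *)
exists (XYMap N D (D ^+ 2 - t%:P) (D ^+ 2)); last by rewrite /isog_deg /= sN.
split => /=.
- split => /=.
  + exact: monicXsubC.
  + by rewrite monic_exp // monicXsubC.
  + rewrite coprimep_XsubC /root.
    have -> : N.[e] = t by rewrite /N !hornerE /=; rewrite /t; ring.
    exact: t0.
  + rewrite coprimep_expr // coprimep_XsubC /root !hornerE /=.
    by have -> : (e - e) ^+ 2 - t = - t; [rewrite /t; ring | rewrite oppr_eq0].
- by rewrite sN size_XsubC.
- rewrite /cubic a b eB -!mul_polyC /N /D /t; ring.
Qed.

End Field.

(** * The denominators of an isogeny of degree 2 *)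

Section IsogenyShape.
Variable k : fieldType.
Implicit Types (E : curve k) (w e : k).

Lemma coefs7_eq0 (c0 c1 c2 c3 c4 c5 c6 : k) :
  c0%:P + c1%:P * 'X + c2%:P * 'X ^+ 2 + c3%:P * 'X ^+ 3 + c4%:P * 'X ^+ 4
    + c5%:P * 'X ^+ 5 + c6%:P * 'X ^+ 6 = 0 ->
  [/\ c0 = 0, c3 = 0, c4 = 0, c5 = 0 & c6 = 0].
Proof.
move=> h; have /polyP c : Poly [:: c0; c1; c2; c3; c4; c5; c6] = 0.
  by rewrite /= !cons_poly_def -h; ring.
by split; [move: (c 0%N)|move: (c 3%N)|move: (c 4%N)|move: (c 5%N)|move: (c 6%N)];
  rewrite coef_Poly coef0.
Qed.

Lemma poly_size3 (q : {poly k}) : size q = 3%N ->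
  q = (q`_0)%:P + (q`_1)%:P * 'X + (q`_2)%:P * 'X ^+ 2.
Proof.
move=> s; rewrite -[LHS]coefK s poly_def !big_ord_recr big_ord0 /=.
by rewrite -!mul_polyC add0r expr0 mulr1 expr1.
Qed.

Lemma monic_size1 (q : {poly k}) : q \is monic -> size q = 1%N -> q = 1.
Proof.
move=> m s; rewrite [LHS]size1_polyC ?s //; move: m.
by rewrite monicE lead_coefE s /= => /eqP ->.
Qed.

Lemma size_cubic E : size (cubic E) = 4%N.
Proof.
rewrite /cubic -addrA size_polyDl size_polyXn //.
apply: leq_ltn_trans (size_polyD _ _) _; rewrite gtn_max.
rewrite (leq_ltn_trans (size_scale_leq _ _)) ?size_polyX //=.
by rewrite (leq_ltn_trans (size_polyC_leq1 _)).
Qed.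

(* Eliminating N/D between X^3 + A X + B and its derivative. *)
Lemma cubic_bezout (N D q : {poly k}) E :
  q %| N ^+ 3 + coefA E *: (N * D ^+ 2) + coefB E *: D ^+ 3 ->
  q %| 3 *: N ^+ 2 + coefA E *: D ^+ 2 -> q %| D ^+ 4.
Proof.
move=> h h'; have d0 := curve_nonsingular E.
rewrite -(dvdpZr _ _ d0).
have -> : (4 * coefA E ^+ 3 + 27 * coefB E ^+ 2) *: D ^+ 4 =
 (6 * (coefA E)%:P * N ^+ 2 - 9 * (coefB E)%:P * N * D
    + 4 * (coefA E)%:P ^+ 2 * D ^+ 2) * (3 *: N ^+ 2 + coefA E *: D ^+ 2)
  - (18 * (coefA E)%:P * N - 27 * (coefB E)%:P * D) *
    (N ^+ 3 + coefA E *: (N * D ^+ 2) + coefB E *: D ^+ 3).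
  rewrite -!mul_polyC; ring.
by rewrite dvdp_sub // dvdp_mull.
Qed.

Lemma deriv_cubic E : (cubic E)^`() = 3 *: 'X ^+ 2 + (coefA E)%:P.
Proof.
rewrite /cubic !derivD derivC addr0 derivXn derivZ derivX alg_polyC.
by rewrite scaler_nat.
Qed.

(** A repeated factor divides the cubic and its derivative; [cubic_bezout] at [N = 'X], [D = 1] then
    makes it a constant. *)
Lemma cubic_squarefree E (q : {poly k}) : q ^+ 2 %| cubic E -> size q = 1%N.
Proof.
move=> qq; have qf : q %| cubic E.
  by apply: dvdp_trans qq; rewrite expr2 dvdp_mulr.
have qf' : q %| (cubic E)^`().
  case/dvdpP: qq => h ->; rewrite expr2 mulrA derivM.
  apply: dvdp_add; first exact: dvdp_mull.
  by apply: dvdp_mulr; apply: dvdp_mull.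
rewrite deriv_cubic in qf'.
have := @cubic_bezout 'X 1 q E; rewrite !expr1n !mulr1 !alg_polyC.
by move=> /(_ qf qf'); rewrite dvdp1 => /eqP.
Qed.

Lemma size_target (N D : {poly k}) E : size N = 3%N -> (size D <= 2)%N ->
  size (N ^+ 3 + coefA E *: (N * D ^+ 2) + coefB E *: D ^+ 3) = 7%N.
Proof.
move=> sN sD; have N0 : N != 0 by rewrite -size_poly_eq0 sN.
have sN3 : size (N ^+ 3) = 7%N.
  by rewrite !exprS !size_mul ?mulf_neq0 ?sN ?size_poly1 ?oner_eq0.
have sD2 n : (size (D ^+ n) <= n.+1)%N.
  apply: leq_trans (size_poly_exp_leq _ _) _; rewrite ltnS -[leqRHS]mul1n leq_mul //.
  by case: (size D) sD => [|[|[]]].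
rewrite -addrA size_polyDl ?sN3 //.
apply: leq_ltn_trans (size_polyD _ _) _; rewrite gtn_max.
rewrite !(leq_ltn_trans (size_scale_leq _ _)) //.
  by rewrite (leq_ltn_trans (sD2 3)).
rewrite (leq_ltn_trans (size_polyMleq _ _)) // sN.
by have := sD2 2; case: size => [|[|[|[]]]].
Qed.

(** Coprimality gives [D^3 %| L^2], and the cofactor [S] divides the squarefree cubic. For linear
    [D] this forces [S = D] and [L = D^2], and the root of [D] is a root of the cubic. *)
Lemma isogeny2_shape E E' phi : isogeny E E' phi -> isog_deg phi = 2%N ->
  exists e, [/\ root (cubic E) e, xden phi = 'X - e%:P &
    yden phi = ('X - e%:P) ^+ 2].
Proof.
case: phi => N D M L [[/= mD mL cND cML] sDN eqG].
rewrite /isog_deg /= => dN; have sN : size N = 3%N.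
  by case: (size N) sDN dN => [|n] //= _ ->.
set G := N ^+ 3 + _ + _ in eqG.
have D0 := monic_neq0 mD; have L0 := monic_neq0 mL.
have sD : (size D <= 2)%N by rewrite -ltnS -sN.
have sG : size G = 7%N by exact: size_target.
have G0 : G != 0 by rewrite -size_poly_eq0 sG.
have cDG : coprimep (D ^+ 3) G.
  apply: coprimep_expl.
  have -> : G = (coefA E' *: (N * D) + coefB E' *: D ^+ 2) * D + N ^+ 3.
    by rewrite /G -!mul_polyC; ring.
  by rewrite coprimep_addl_mul coprimep_expr // coprimep_sym.
have [S eS] : exists S, L ^+ 2 = S * D ^+ 3.
  apply/dvdpP; rewrite -(Gauss_dvdpl _ cDG) -eqG.
  by rewrite -mulrA dvdp_mulr.
have {}eqG : M ^+ 2 * cubic E = S * G.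
  apply: (mulfI (expf_neq0 3 D0)); rewrite mulrA eqG eS; ring.
have cMS : coprimep (M ^+ 2) S.
  apply: (@coprimep_dvdl _ (L ^+ 2)); first by rewrite eS dvdp_mulr.
  by rewrite coprimep_expl // coprimep_expr.
have Sf : S %| cubic E.
  by rewrite -(@Gauss_dvdpr _ _ (M ^+ 2)) 1?coprimep_sym // eqG dvdp_mulr.
have S0 : S != 0.
  by apply: contra_neq (expf_neq0 2 L0) => S0; rewrite eS S0 mul0r.
have M0 : M != 0.
  have : M ^+ 2 * cubic E != 0 by rewrite eqG mulf_neq0.
  by rewrite mulf_eq0 expf_eq0 /= negb_or => /andP[].
move: sD; rewrite leq_eqVlt ltnS => /orP[/eqP sD|].
  have [e eD] : exists e, D = 'X - e%:P.
    exists (- D`_0); rewrite -[LHS]coefK sD poly_def !big_ord_recr big_ord0 /=.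
    move: mD; rewrite monicE lead_coefE sD /= => /eqP ->.
    by rewrite add0r expr0 expr1 scale1r alg_polyC polyCN opprK addrC.
  have iD h : D %| h ^+ 2 -> D %| h.
    rewrite eD !dvdp_XsubCl !rootE horner_exp expf_eq0 => /andP[] //.
  have /dvdpP[L1 eL1] : D %| L.
    by apply: iD; rewrite eS dvdp_mull // exprS dvdp_mulr.
  have {}eS : L1 ^+ 2 = S * D.
    by apply: (mulfI (expf_neq0 2 D0)); rewrite mulrC -exprMn -eL1 eS; ring.
  have /dvdpP[L2 eL2] : D %| L1 by apply: iD; rewrite eS dvdp_mull.
  have {}eS : S = L2 ^+ 2 * D.
    by apply: (mulIf D0); rewrite -eS eL2; ring.
  have sL2 : size L2 = 1%N.
    by apply: (@cubic_squarefree E); apply: dvdp_trans Sf; rewrite eS dvdp_mulr.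
  have L21 : L2 = 1.
    move: mL; rewrite eL1 eL2 !monicMr ?mD // => mL2.
    by apply: monic_size1.
  exists e; split=> //; last by rewrite eL1 eL2 L21 eD; ring.
  by rewrite -dvdp_XsubCl -eD; apply: dvdp_trans Sf; rewrite eS dvdp_mull.
(* If [D] is constant then so is [L], and [M ^+ 2 * cubic E = G] equates an odd degree with 6. *)
rewrite leq_eqVlt ltnS leqn0 size_poly_eq0 (negPf D0) orbF => /eqP sD.
have D1 : D = 1 by apply: monic_size1.
have sL : size L = 1%N.
  apply: (@cubic_squarefree E); apply: dvdp_trans Sf.
  by rewrite eS D1 expr1n mulr1.
have S1 : S = 1.
  have L1 : L = 1 by apply: monic_size1.
  by move: eS; rewrite L1 D1 !expr1n mulr1.
have := congr1 (fun q : {poly k} => size q) eqG; rewrite S1 mul1r sG expr2.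
have f0 : cubic E != 0 by rewrite -size_poly_eq0 size_cubic.
rewrite size_mul ?mulf_neq0 // size_mul // size_cubic.
rewrite -size_poly_eq0 in M0; case: (size M) M0 => // n _.
by rewrite addnC !addSn addnS /= => -[] /(congr1 odd); rewrite addnn /= odd_double.
Qed.

End IsogenyShape.

(** * Every isogeny of degree 2 is a Velu quotient up to scaling *)

Section QuotClassify.
Variable k : fieldType.
Hypotheses (k2 : (2 : k) != 0) (k3 : (3 : k) != 0).
Implicit Types (E : curve k) (w e : k).

Lemma rootE_cubic E e :
  root (cubic E) e = (e ^+ 3 + coefA E * e + coefB E == 0).
Proof. by rewrite rootE /cubic !hornerE. Qed.

(** All polynomials are expanded in powers of [D = X - e]. Once [M] is known to be a constant [m]
    times the numerator of the derivative of [N / D], comparing coefficients leaves only the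
    abscissa [m^2 (x + t / (x - e))], which is Velu's map followed by scaling by [m]. *)
Lemma isogeny2_quot E E' phi : isogeny E E' phi -> isog_deg phi = 2%N ->
  exists e E'' u, quot_by E e E'' /\ scale_iso u E'' E'.
Proof.
move=> iso dN; have [e [re]] := isogeny2_shape iso dN.
case: phi iso dN => N D M L [[/= mD mL cND cML] sDN eqG] + eD eL.
rewrite /isog_deg /= => dN; have sN : size N = 3%N.
  by case: (size N) sDN dN => [|n] //= _ ->.
have sD : size D = 2 by rewrite eD size_XsubC.
set G := N ^+ 3 + _ + _ in eqG.
have D0 := monic_neq0 mD.
have sG : size G = 7%N by apply: size_target; rewrite ?sD.
have G0 : G != 0 by rewrite -size_poly_eq0 sG.
rewrite rootE_cubic in re; move/eqP in re.
have eB : coefB E = - (e ^+ 3 + coefA E * e).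
  by apply/eqP; rewrite -addr_eq0 addrC re.
have [t0 d0] := root_disc re; set t := 3 * e ^+ 2 + coefA E in t0 *.
(* This is [cubic E] divided by [D]. *)
pose g := D ^+ 2 + (3 * e)%:P * D + t%:P.
have eqM : M ^+ 2 * g = G.
  apply: (mulfI (expf_neq0 4 D0)).
  have <- : D ^+ 3 * M ^+ 2 * cubic E = D ^+ 4 * G by rewrite eqG eL -eD; ring.
  rewrite /g /cubic eD eB -mul_polyC /t; ring.
have [c0 [c1 [c2 [c20 eN]]]] : exists c0 c1 c2, c2 != 0 /\
    N = c0%:P + c1%:P * D + c2%:P * D ^+ 2.
  pose q := N \Po ('X + e%:P).
  have sq : size q = 3%N by rewrite size_comp_poly2 ?size_XaddC.
  exists q`_0, q`_1, q`_2; split.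
    have : lead_coef q != 0 by rewrite lead_coef_eq0 -size_poly_eq0 sq.
    by rewrite lead_coefE sq.
  rewrite -[LHS](comp_polyXaddC_K _ e) -/q {1}(poly_size3 sq) -eD.
  by rewrite !(comp_polyD, comp_polyM, comp_polyC, comp_polyX).
have c00 : c0 != 0.
  move: cND; rewrite eD coprimep_XsubC rootE eN eD !hornerE /= subrr.
  by rewrite !mulr0 !addr0.
have dD : D^`() = 1 by rewrite eD derivXsubC.
(* W = N' D - N D'; a double root of G(N, D) is a critical point of N / D. *)
pose W := c2%:P * D ^+ 2 - c0%:P.
pose GN := 3 *: N ^+ 2 + coefA E' *: D ^+ 2.
have MW : M %| W.
  have MG : M %| G by rewrite -eqM expr2 -mulrA dvdp_mulr.
  have MG' : M %| G^`().
    rewrite -eqM expr2 -mulrA derivM.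
    by apply: dvdp_add; [apply: dvdp_mull; exact: dvdp_mulr | exact: dvdp_mulr].
  (* [GN] is the partial derivative of [G] in [N]. A common factor with [M] would divide [D^4] by
     [cubic_bezout], but [M] is coprime to [L = D^2]. *)
  have cMG : coprimep M GN.
    apply/coprimepP => q qM qG; rewrite -size_poly_eq1 -dvdp1.
    have qD : q %| D ^+ 4 by apply: cubic_bezout qG; apply: dvdp_trans MG.
    rewrite -(@Gauss_dvdpr _ 1 (D ^+ 4)) ?mulr1 //.
    apply: coprimep_dvdr qM _; apply: coprimep_expr.
    by apply: coprimep_dvdl cML; rewrite eL eD expr2 dvdp_mulr.
  rewrite -(Gauss_dvdpr _ cMG).
  (* Euler's relation for [G], a form of degree 3 in [N] and [D], with [D' = 1]. *)
  have -> : GN * W = D * G^`() - 3 * G.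
    rewrite /GN /W /G -!mul_polyC !(derivD, derivM, deriv_exp, derivC) dD.
    rewrite eN !(derivD, derivM, deriv_exp, derivC) dD /=; ring.
  by apply: dvdp_sub; exact: dvdp_mull.
have sW : size W = 3%N.
  have sD2 : size (c2 *: D ^+ 2) = 3%N by rewrite size_scale // eD size_exp_XsubC.
  rewrite /W mul_polyC size_polyDl sD2 // size_polyN.
  by rewrite (leq_ltn_trans (size_polyC_leq1 _)).
have sg : size g = 3%N.
  rewrite /g -addrA size_polyDl eD size_exp_XsubC //.
  apply: leq_ltn_trans (size_polyD _ _) _; rewrite gtn_max.
  rewrite mul_polyC (leq_ltn_trans (size_scale_leq _ _)) ?size_XsubC //=.
  by rewrite (leq_ltn_trans (size_polyC_leq1 _)).
have sM : size M = 3%N.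
  have M0 : M != 0 by apply: contra_neq G0 => M0; rewrite -eqM M0 expr0n mul0r.
  have g0 : g != 0 by rewrite -size_poly_eq0 sg.
  have := congr1 (fun q : {poly k} => size q) eqM.
  rewrite sG expr2 size_mul ?mulf_neq0 // size_mul // sg.
  rewrite -size_poly_eq0 in M0; case: (size M) M0 => // n _.
  rewrite addnC !addSn addnS addnn /= => -[] /(congr1 half); rewrite doubleK.
  by move->.
have [m m0 eM] : exists2 m, m != 0 & M = m%:P * W.
  have /eqpfP eMW : M %= W by rewrite -(dvdp_size_eqp MW) sM sW.
  exists (lead_coef M / lead_coef W); last by rewrite mul_polyC.
  by rewrite mulf_neq0 ?invr_eq0 // lead_coef_eq0 -size_poly_eq0 ?sM ?sW.
(* The [z]'s are the coefficients of [M ^+ 2 * g - G] in powers of [D]. Below, [z6], [z5] and [z0]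
   determine [c2], [c1] and [c0]; then [z4] and [z3] determine the coefficients of [E']. *)
pose z0 := m ^+ 2 * c0 ^+ 2 * t - c0 ^+ 3.
pose z1 := m ^+ 2 * c0 ^+ 2 * (3 * e) - 3 * c0 ^+ 2 * c1.
pose z2 := m ^+ 2 * (c0 ^+ 2 - 2 * c2 * c0 * t)
  - (3 * c0 * c1 ^+ 2 + 3 * c0 ^+ 2 * c2 + coefA E' * c0).
pose z3 := m ^+ 2 * (- 2 * c2 * c0 * (3 * e))
  - (c1 ^+ 3 + 6 * c0 * c1 * c2 + coefA E' * c1 + coefB E').
pose z4 := m ^+ 2 * (c2 ^+ 2 * t - 2 * c2 * c0)
  - (3 * c2 * c1 ^+ 2 + 3 * c2 ^+ 2 * c0 + coefA E' * c2).
pose z5 := m ^+ 2 * c2 ^+ 2 * (3 * e) - 3 * c2 ^+ 2 * c1.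
pose z6 := m ^+ 2 * c2 ^+ 2 - c2 ^+ 3.
have : (z0%:P + z1%:P * 'X + z2%:P * 'X ^+ 2 + z3%:P * 'X ^+ 3 + z4%:P * 'X ^+ 4
    + z5%:P * 'X ^+ 5 + z6%:P * 'X ^+ 6) \Po D = 0.
  rewrite !(comp_polyD, comp_polyM, comp_polyC, comp_polyX, rmorphXn) /=.
  transitivity (M ^+ 2 * g - G); last by rewrite eqM subrr.
  rewrite eM /G eN /g /W -!mul_polyC /z0 /z1 /z2 /z3 /z4 /z5 /z6; ring.
move/eqP; rewrite comp_poly2_eq0 // => /eqP /coefs7_eq0[].
rewrite {}/z0 {}/z3 {}/z4 {}/z5 {}/z6 {z1 z2} => z0 z3 z4 z5 z6.
have nul (x y : k) : x != 0 -> x * y = 0 -> y = 0.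
  by move=> x0 /eqP; rewrite mulf_eq0 (negPf x0) => /eqP.
have e2 : c2 = m ^+ 2.
  apply/esym/subr0_eq; apply: (nul (c2 ^+ 2)); rewrite ?expf_neq0 //.
  by rewrite -z6; ring.
have e1 : c1 = m ^+ 2 * e.
  apply/esym/subr0_eq; apply: (nul (3 * c2 ^+ 2)); first by rewrite mulf_neq0 ?expf_neq0.
  by rewrite -z5; ring.
have e0 : c0 = m ^+ 2 * t.
  apply/esym/subr0_eq; apply: (nul (c0 ^+ 2)); rewrite ?expf_neq0 //.
  by rewrite -z0; ring.
rewrite {}e0 {}e1 {}e2 in z3 z4.
have eA' : coefA E' = m ^+ 4 * - (4 * coefA E + 15 * e ^+ 2).
  apply/esym/subr0_eq; apply: (nul (m ^+ 2)); rewrite ?expf_neq0 //.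
  by rewrite -z4 /t; ring.
have eB' : coefB E' = m ^+ 6 * - (22 * e ^+ 3 + 8 * coefA E * e).
  by apply/esym/subr0_eq; rewrite -z3 eA' /t; ring.
have [E'' q] := quot_exists k2 re.
exists e, E'', m; split=> //; case: q => _ a b.
by split; rewrite ?a ?b.
Qed.
End QuotClassify.

(** * Two quotients of one curve with the same j-invariant *)

Section DoubleEdge.
Variable k : fieldType.
Hypotheses (k2 : (2 : k) != 0) (k3 : (3 : k) != 0).
Implicit Types (E : curve k) (e s : k).

(** Vieta's formulas, the third root being [- (e + s)]. *)
Lemma two_roots E e s : e != s ->
  e ^+ 3 + coefA E * e + coefB E = 0 -> s ^+ 3 + coefA E * s + coefB E = 0 ->
  coefA E = - (e ^+ 2 + e * s + s ^+ 2) /\ coefB E = e * s * (e + s).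
Proof.
move=> es re rs.
have eA : coefA E = - (e ^+ 2 + e * s + s ^+ 2).
  have es0 : e - s != 0 by rewrite subr_eq0.
  apply/subr0_eq/(mulfI es0); rewrite mulr0 -[RHS](subrr 0) -{1}re -rs; ring.
split=> //; apply/subr0_eq; rewrite -re eA; ring.
Qed.

(** These are the differences between [s], respectively [e], and the third root; the discriminant is
    a product of squared differences. *)
Lemma roots_neq0 E e s : e != s ->
  e ^+ 3 + coefA E * e + coefB E = 0 -> s ^+ 3 + coefA E * s + coefB E = 0 ->
  e + 2 * s != 0 /\ 2 * e + s != 0.
Proof.
move=> es re rs; have [eA eB] := two_roots es re rs.
have := curve_nonsingular E.
have -> : 4 * coefA E ^+ 3 + 27 * coefB E ^+ 2 =
    - ((e - s) * (e + 2 * s) * (2 * e + s)) ^+ 2 by rewrite eA eB; ring.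
by rewrite oppr_eq0 expf_eq0 /= !mulf_eq0 !negb_or => /andP[/andP[]].
Qed.

(** Legendre's formula in terms of the differences of the roots: the expression cubed is
    [- 3 * coefA E]. *)
Lemma jinv_roots E e s : e != s ->
  e ^+ 3 + coefA E * e + coefB E = 0 -> s ^+ 3 + coefA E * s + coefB E = 0 ->
  jinv E = 256 * ((e - s) ^+ 2 + (e + 2 * s) * (2 * e + s)) ^+ 3
             / ((e - s) * (e + 2 * s) * (2 * e + s)) ^+ 2.
Proof.
move=> es re rs; have [eA eB] := two_roots es re rs.
have [Q0 R0] := roots_neq0 es re rs.
rewrite /jinv.
have -> : 4 * coefA E ^+ 3 + 27 * coefB E ^+ 2 =
    - ((e - s) * (e + 2 * s) * (2 * e + s)) ^+ 2 by rewrite eA eB; ring.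
rewrite invrN mulrN -mulNr; congr (_ / _).
by rewrite eA; ring.
Qed.

(** Here [(e - s) * (2 * e + s)] is the derivative of the cubic at [e], and [(e + 2 * s) ^+ 2] is
    the discriminant of its cofactor, so the denominator is the discriminant of the quotient up to a
    constant. *)
Lemma jinv_quot_roots E E' e s : e != s ->
  s ^+ 3 + coefA E * s + coefB E = 0 -> quot_by E e E' ->
  jinv E' = 16 * ((e + 2 * s) ^+ 2 + 16 * ((e - s) * (2 * e + s))) ^+ 3
             / ((e + 2 * s) ^+ 4 * ((e - s) * (2 * e + s))).
Proof.
move=> es rs [re a b]; have [eA eB] := two_roots es re rs.
rewrite /jinv.
have -> : 4 * coefA E' ^+ 3 + 27 * coefB E' ^+ 2 =
   - 2 ^+ 4 * ((e + 2 * s) ^+ 4 * ((e - s) * (2 * e + s))).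
  by rewrite a b eA; ring.
have -> : 1728 * (4 * coefA E' ^+ 3) = - 2 ^+ 4 *
   (16 * ((e + 2 * s) ^+ 2 + 16 * ((e - s) * (2 * e + s))) ^+ 3).
  by rewrite a eA; ring.
rewrite -[LHS]mulf_div divff ?mul1r // oppr_eq0 expf_neq0 //.
Qed.

(* The discriminant of Phi_2(X, Y) in Y is, up to a constant,
   X^2 (X - 1728) (X + 3375)^2 (X^2 + 191025 X - 495^3)^2; the four cases
   are its factors.  At X = -3375 the double edge is a loop. *)
Lemma double_edge E E1 E2 e s : e != s ->
  quot_by E e E1 -> quot_by E s E2 -> jinv E1 = jinv E2 ->
  [\/ coefA E = 0, coefB E = 0, jinv E1 = jinv E |
      jinv E ^+ 2 + 225 * 849 * jinv E - 495 ^+ 3 = 0 /\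
      jinv E1 = - (jinv E + 225 * 849) ].
Proof.
move=> es q1 q2; have [re _ _] := q1; have [rs _ _] := q2.
have [eA eB] := two_roots es re rs; have [Q0 R0] := roots_neq0 es re rs.
rewrite (jinv_quot_roots _ rs q1) // (jinv_quot_roots _ re q2) 1?eq_sym //.
rewrite (jinv_roots es re rs).
have P0 : e - s != 0 by rewrite subr_eq0.
have -> : coefA E = - ((e - s) ^+ 2 + (e + 2 * s) * (2 * e + s)) / 3.
  by rewrite eA; field.
(* The three factors are [3 * e], [3 * s] and [3 * (e + s)]. *)
have -> : coefB E = (2 * (e - s) + (e + 2 * s)) * ((e + 2 * s) - (e - s)) *
    (2 * (e + 2 * s) + (e - s)) / 27.
  rewrite eB; field; exact: (natr23_neq0 k2 k3 0 3).
have -> : s + 2 * e = 2 * e + s by ring.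
have -> : 2 * s + e = e + 2 * s by ring.
rewrite -[s - e]opprB.
have: 2 * e + s = (e - s) + (e + 2 * s) by ring.
move: Q0 R0 P0; move: (e - s) (e + 2 * s) (2 * e + s) => P Q R Q0 R0 P0 eR h.
have n2 : (16 : k) != 0 by rewrite (natr23_neq0 k2 k3 4 0).
(* This is the difference of the two j-invariants with denominators cleared, using [R = P + Q]. Its
   factors mean, in order, [B = 0], [A = 0], [j = -3375] and discriminant -15. *)
have : 16 * ((Q + R) * (P ^+ 2 + Q * R) * (Q * R + 16 * P ^+ 2) *
   (Q ^+ 2 * R ^+ 2 + 752 * (Q * R * P ^+ 2) + 256 * P ^+ 4)) = 0.
  move/eqP: h; rewrite -subr_eq0 => /eqP h.
  transitivity (Q ^+ 4 * R ^+ 4 * P * 0); last by rewrite mulr0.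
  rewrite -h eR; rewrite eR in R0; field; by rewrite oppr_eq0 ?P0 ?Q0 ?R0.
move/eqP; rewrite !mulf_eq0 (negPf n2) /= -!orbA => /or4P[] /eqP z.
- apply: Or42; have -> : 2 * Q + P = Q + R by rewrite eR; ring.
  by rewrite z mulr0 mul0r.
- by apply: Or41; rewrite z oppr0 mul0r.
- apply: Or43; apply/subr0_eq.
  (* The vanishing factor divides the numerator of [jinv E1 - jinv E]; the long sextic is the
     cofactor. *)
  have -> : 16 * (Q ^+ 2 + 16 * (P * R)) ^+ 3 / (Q ^+ 4 * (P * R)) -
      256 * (P ^+ 2 + Q * R) ^+ 3 / (P * Q * R) ^+ 2 =
    (Q * R + 16 * P ^+ 2) * 16 * (2 ^+ 12 * P ^+ 6 + 2 ^+ 8 * 63 * P ^+ 5 * Q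
      + 2 ^+ 9 * 47 * P ^+ 4 * Q ^+ 2
      + 2 ^+ 8 * 63 * P ^+ 3 * Q ^+ 3 + 2 ^+ 8 * 15 * P ^+ 2 * Q ^+ 4 - 496 * P * Q ^+ 5
      - 256 * Q ^+ 6) / (16 * P ^+ 2 * Q ^+ 4 * R ^+ 2).
    by rewrite eR; rewrite eR in R0; field; rewrite ?P0 ?Q0 ?R0 ?n2.
  by rewrite z !mul0r.
- apply: Or44; split.
    (* The vanishing quartic divides the numerator of the class polynomial evaluated at [jinv E];
       the form of degree 8 is the cofactor. *)
    transitivity ((Q ^+ 2 * R ^+ 2 + 752 * (Q * R * P ^+ 2) + 256 * P ^+ 4) *
      (256 * P ^+ 8 + 784 * P ^+ 7 * Q + (440 ^+ 2 - 255) * P ^+ 6 * Q ^+ 2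
       + (630 ^+ 2 + 766) * P ^+ 5 * Q ^+ 3 + (543 ^+ 2 + 880) * P ^+ 4 * Q ^+ 4
       + 2 ^+ 8 * 1171 * P ^+ 3 * Q ^+ 5 + 2 ^+ 8 * 1585 * P ^+ 2 * Q ^+ 6
       + 2 ^+ 18 * P * Q ^+ 7 + 2 ^+ 16 * Q ^+ 8) / (P * Q * R) ^+ 4);
      last by rewrite z !mul0r.
    by rewrite eR; rewrite eR in R0; field; rewrite ?P0 ?Q0 ?R0 ?n2.
  apply/subr0_eq.
  transitivity ((Q ^+ 2 * R ^+ 2 + 752 * (Q * R * P ^+ 2) + 256 * P ^+ 4) *
    (256 * P ^+ 4 + 272 * P ^+ 3 * Q + 33 * P ^+ 2 * Q ^+ 2 + 272 * P * Q ^+ 3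
     + 256 * Q ^+ 4) / (P ^+ 2 * Q ^+ 4 * R ^+ 2));
    last by rewrite z !mul0r.
  by rewrite eR; rewrite eR in R0; field; rewrite ?P0 ?Q0 ?R0 ?n2.
Qed.

End DoubleEdge.

(** * Quotients by an equivalence relation *)

Section Quotient.
Variables (T : Type) (R : T -> T -> Prop).

Lemma quotient_ext (q q' : quotient R) : members q = members q' -> q = q'.
Proof.
case: q q' => m h [m' h'] /= e; case: _ / e in h' *.
by rewrite (Prop_irrelevance h h').
Qed.

Lemma class_surj (q : quotient R) : exists x, q = class R x.
Proof. by case: (membersP q) => x e; exists x; apply: quotient_ext. Qed.

Hypotheses (R_refl : forall x, R x x) (R_sym : forall x y, R x y -> R y x)
  (R_trans : forall x y z, R x y -> R y z -> R x z).

Lemma classP x y : class R x = class R y <-> R x y.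
Proof.
split=> [e|xy].
  by have : members (class R y) y by []; rewrite -e.
apply/quotient_ext/seteqP; split=> z /=.
  by apply: R_trans; apply: R_sym.
exact: R_trans.
Qed.

Lemma membersE (q : quotient R) x : members q x <-> q = class R x.
Proof.
have [y ->] := class_surj q; rewrite classP; exact: iff_refl.
Qed.

End Quotient.

(** * Base change along a field morphism *)

Section Rmorph.
Variables (k K : fieldType) (f : {rmorphism k -> K}).

Lemma map_jinv (E : curve k) : jinv (map_curve f E) = f (jinv E).
Proof.
by rewrite /jinv /= fmorph_div; congr (_ / _); ring.
Qed.

Lemma map_quot_by (E : curve k) e E' :
  quot_by E e E' -> quot_by (map_curve f E) (f e) (map_curve f E').
Proof.
case=> r a b; by split => /=; rewrite ?a ?b -1?[RHS](rmorph0 f) -1?r; ring.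
Qed.

End Rmorph.

(** * Curves with the same j-invariant *)

Section Jinvariant.
Variable k : fieldType.
Hypotheses (k2 : (2 : k) != 0) (k3 : (3 : k) != 0).
Implicit Types E : curve k.

(** The only candidate is [r = (B' / B) / (A' / A)]; equality of the j-invariants amounts to
    [A^3 B'^2 = A'^3 B^2], which makes it work. *)
Lemma jinv_eq_twist E E' : jinv E = jinv E' ->
  coefA E != 0 -> coefB E != 0 ->
  exists2 r, r != 0 & coefA E' = r ^+ 2 * coefA E /\ coefB E' = r ^+ 3 * coefB E.
Proof.
move=> ej A0 B0.
have A0' : coefA E' != 0 by rewrite -jinv_eq0 // -ej jinv_eq0.
have B0' : coefB E' != 0 by rewrite -jinv_eq1728 // -ej jinv_eq1728.
have n0 : (1728 * 4 * 27 : k) != 0.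
  by rewrite !mulf_neq0 ?(natr23_neq0 k2 k3 6 3) ?(natr23_neq0 k2 k3 2 0)
    ?(natr23_neq0 k2 k3 0 3).
have h : coefA E ^+ 3 * coefB E' ^+ 2 = coefA E' ^+ 3 * coefB E ^+ 2.
  move/eqP: ej; rewrite /jinv eqr_div ?curve_nonsingular // => /eqP ej.
  apply: (mulfI n0); apply/subr0_eq; move/eqP: ej; rewrite -subr_eq0 => /eqP <-.
  ring.
exists (coefB E' * coefA E / (coefB E * coefA E')).
  by rewrite mulf_neq0 ?invr_neq0 ?mulf_neq0.
split.
  have -> : (coefB E' * coefA E / (coefB E * coefA E')) ^+ 2 * coefA E =
    coefA E ^+ 3 * coefB E' ^+ 2 / (coefB E * coefA E') ^+ 2.
    by field; rewrite A0' B0.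
  by rewrite h; field; rewrite A0' B0.
have -> : (coefB E' * coefA E / (coefB E * coefA E')) ^+ 3 * coefB E =
    coefB E' * (coefA E ^+ 3 * coefB E' ^+ 2) / (coefB E ^+ 2 * coefA E' ^+ 3).
  by field; rewrite A0' B0.
by rewrite h; field; rewrite A0' B0.
Qed.

End Jinvariant.

(** * Isomorphism and supersingularity over an algebraically closed field *)

Section ClosedField.
Variable K : closedFieldType.
Hypotheses (k2 : (2 : K) != 0) (k3 : (3 : K) != 0).
Implicit Types E : curve K.

Lemma closed_root_exp n (c : K) : (0 < n)%N -> exists w, w ^+ n = c.
Proof.
move=> n0; have /closed_rootP[w] : size ('X^n - c%:P) != 1%N.
  by rewrite size_XnsubC // eqSS -lt0n.
by rewrite rootE !hornerE subr_eq0 => /eqP; exists w.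
Qed.

(** The scale is a sixth root when [A = 0], a fourth root when [B = 0], and otherwise a square root
    of the twisting factor. *)
Lemma jinv_eq_iso E E' : jinv E = jinv E' -> exists w, scale_iso w E E'.
Proof.
move=> ej; have d0 := curve_nonsingular E; have d0' := curve_nonsingular E'.
have [A0|A0] := eqVneq (coefA E) 0.
  have A0' : coefA E' = 0 by apply/eqP; rewrite -jinv_eq0 // -ej jinv_eq0 ?A0.
  have B0 : coefB E != 0 by apply: contra_neq d0 => B0; rewrite A0 B0; ring.
  have B0' : coefB E' != 0 by apply: contra_neq d0' => B0'; rewrite A0' B0'; ring.
  have [w hw] := @closed_root_exp 6 (coefB E' / coefB E) isT.
  exists w; split; rewrite ?A0 ?A0' ?mulr0 ?hw ?divfK //.
  have : w ^+ 6 != 0 by rewrite hw mulf_neq0 ?invr_neq0.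
  by rewrite expf_eq0.
have [B0|B0] := eqVneq (coefB E) 0.
  have A0' : coefA E' != 0 by rewrite -jinv_eq0 // -ej jinv_eq0.
  have B0' : coefB E' = 0.
    by apply/eqP; rewrite -jinv_eq1728 // -ej jinv_eq1728 ?B0.
  have [w hw] := @closed_root_exp 4 (coefA E' / coefA E) isT.
  exists w; split; rewrite ?B0 ?B0' ?mulr0 ?hw ?divfK //.
  have : w ^+ 4 != 0 by rewrite hw mulf_neq0 ?invr_neq0.
  by rewrite expf_eq0.
have [r r0 [a b]] := jinv_eq_twist k2 k3 ej A0 B0.
have [w hw] := @closed_root_exp 2 r isT.
exists w; split; rewrite ?a ?b -?hw -?exprM //.
by move: r0; rewrite -hw expf_eq0.
Qed.

Lemma supersingular_scale p w E E' :
  scale_iso w E E' -> supersingular p E -> supersingular p E'.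
Proof.
move=> iso ss P onP itP; have [w0 _ _] := iso.
have iso' := scale_iso_sym iso.
have it n : iter n (addP E (scale_point w^-1 P)) None =
    scale_point w^-1 (iter n (addP E' P) None).
  by elim: n => //= n ->; rewrite (addP_scale _ _ iso').
have /(_ _ _)/= := ss (scale_point w^-1 P).
rewrite (on_curve_scale _ iso') it itP => /(_ onP erefl).
by case: P {onP itP it} => [[]|].
Qed.

(** [supersingular_j] only provides some supersingular curve with this j-invariant; this transfers
    the property to a given one. *)
Lemma supersingular_jinv p E : supersingular_j p (jinv E) -> supersingular p E.
Proof.
by case=> E0 ss /jinv_eq_iso[w iso]; apply: supersingular_scale iso ss.
Qed.

End ClosedField.

(** * Adjacency over the base field, and neighbours of 0 and 1728 *)

Section Graph.
Variables (p : nat) (F : fieldType) (K : closedFieldType).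
Variable iota : {rmorphism F -> K}.
Local Notation ss_curve := (ss_curve p iota).
Local Notation vertex := (vertex p iota).
Local Notation edge := (edge p iota).
Local Notation ss_iso := (@ss_iso p F K iota).
Local Notation isog_equiv := (@isog_equiv p F K iota).
Implicit Types (E : ss_curve) (v w : vertex).

Lemma ss_iso_refl E : ss_iso E E.
Proof. by exists 1; exact: scale_iso_refl. Qed.

Lemma ss_iso_sym E E' : ss_iso E E' -> ss_iso E' E.
Proof. by case=> w /scale_iso_sym h; exists w^-1. Qed.

Lemma ss_iso_trans E E' E'' : ss_iso E E' -> ss_iso E' E'' -> ss_iso E E''.
Proof. by case=> w h [z h']; exists (z * w); exact: scale_iso_trans h h'. Qed.

Lemma vertexP E E' : vertex_of E = vertex_of E' <-> ss_iso E E'.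
Proof. exact: classP ss_iso_refl ss_iso_sym ss_iso_trans _ _. Qed.

Lemma vertex_surj v : exists E, v = vertex_of E.
Proof. exact: class_surj. Qed.

Lemma members_vertex v E : members v E <-> v = vertex_of E.
Proof. exact: membersE ss_iso_refl ss_iso_sym ss_iso_trans _ _. Qed.

Lemma members_edge (e : edge) phi : members e phi <-> e = class isog_equiv phi.
Proof.
by apply: membersE; [exact: rst_refl | exact: rst_sym | exact: rst_trans].
Qed.

Lemma vertex_j_of E : vertex_j (vertex_of E) = jinv E.
Proof.
(* The class is nonempty, so the default value 0 is never taken. *)
have /= := @xgetPex _ 0 [set jinv (ss_val E') | E' in members (vertex_of E)].
case; first by exists (jinv E), E => //; exact: ss_iso_refl.
by move=> E' [w iso] j; exact: etrans (esym j) (jinv_scale iso).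
Qed.

Lemma adjacentP v w : adjacent v w <-> exists phi : isogeny2 p iota,
  (v = vertex_of (isog_src phi) /\ w = vertex_of (isog_tgt phi)) \/
  (w = vertex_of (isog_src phi) /\ v = vertex_of (isog_tgt phi)).
Proof.
split=> [[e [phi _]]|[phi h]].
  by rewrite !members_vertex => h; exists phi.
exists (class isog_equiv phi), phi; first exact: rst_refl.
by rewrite !members_vertex.
Qed.

Hypotheses (F2 : (2 : F) != 0) (F3 : (3 : F) != 0).

Lemma quot_adjacent E E' e : quot_by E e E' ->
  adjacent (vertex_of E) (vertex_of E').
Proof.
by case/quot_isogeny=> phi iso d; apply/adjacentP; exists (Isogeny2 iso d); left.
Qed.

Lemma adjacent_quot E w : adjacent (vertex_of E) w ->
  exists e (E' : curve F), quot_by E e E' /\ jinv E' = vertex_j w.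
Proof.
case/adjacentP=> phi h; have [e [E1 [u [q iso]]]] :=
  isogeny2_quot F2 F3 (isog_mapP phi) (isog_map_deg phi).
case: h => -[].
  move=> /vertexP /ss_iso_sym [w0 isoE] ->.
  have [E2 q2 iso2] := quot_scale F2 isoE q.
  exists (w0 ^+ 2 * e), E2; split=> //.
  by rewrite vertex_j_of (jinv_scale iso2) (jinv_scale iso).
(* Here the isogeny ends at [E], and the edge is followed backwards along the dual quotient. *)
move=> -> /vertexP /ss_iso_sym [w0 isoE]; rewrite vertex_j_of.
have [E2 q2 iso2] := quot_dual F2 q.
have [E3 q3 iso3] := quot_scale F2 (scale_iso_trans iso isoE) q2.
exists ((w0 * u) ^+ 2 * - (2 * e)), E3; split=> //.
by rewrite (jinv_scale iso3) (jinv_scale iso2).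
Qed.

Lemma ss_exists (E0 : curve F) : supersingular_j p (iota (jinv E0)) ->
  exists E, ss_val E = E0.
Proof.
move=> s; have h : supersingular p (map_curve iota E0).
  apply: supersingular_jinv; rewrite ?map_jinv //.
    by rewrite -(rmorph_nat iota) fmorph_eq0.
  by rewrite -(rmorph_nat iota) fmorph_eq0.
by exists (SSCurve h).
Qed.

Lemma ss_vertex_j E : supersingular_j p (iota (jinv E)).
Proof. by exists (map_curve iota E); [exact: ss_valP | rewrite map_jinv]. Qed.

Lemma jinv_quot_1728 (E E' : curve F) e : quot_by E e E' -> coefB E = 0 ->
  jinv E' = if e == 0 then 1728 else 66 ^+ 3.
Proof.
move=> [r a b] B0; rewrite B0 addr0 in r.
case: eqP => [e0|/eqP e0].
  by apply/eqP; rewrite jinv_eq1728 // b e0 mulr0 expr0n mulr0 addr0 oppr0.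
have eA : coefA E = - e ^+ 2.
    by apply/subr0_eq/(mulfI e0); rewrite mulr0 -r; ring.
rewrite /jinv a b eA.
have -> : 4 * (- (4 * - e ^+ 2 + 15 * e ^+ 2)) ^+ 3 +
  27 * (- (22 * e ^+ 3 + 8 * - e ^+ 2 * e)) ^+ 2 = - 2 ^+ 5 * e ^+ 6 by ring.
field; rewrite e0 oppr_eq0 /=.
by rewrite (natr23_neq0 F2 F3 5 0).
Qed.

Lemma jinv_quot_0 (E E' : curve F) e : quot_by E e E' -> coefA E = 0 ->
  jinv E' = 2 * 30 ^+ 3.
Proof.
move=> [r a b] A0; rewrite A0 mul0r addr0 in r.
have e0 : e != 0.
  apply: contra_neq (curve_nonsingular E) => e0.
  have -> : coefB E = 0 by rewrite -r e0; ring.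
  by rewrite A0; ring.
rewrite /jinv a b A0.
have -> : 4 * (- (4 * 0 + 15 * e ^+ 2)) ^+ 3 +
  27 * (- (22 * e ^+ 3 + 8 * 0 * e)) ^+ 2 = - (2 ^+ 4 * 3 ^+ 3) * e ^+ 6 by ring.
field; rewrite e0 oppr_eq0 /=.
by rewrite (natr23_neq0 F2 F3 4 3).
Qed.

(** At 0 all neighbours share one j-invariant. At 1728 both vertices have a neighbour with j = 1728,
    so a new neighbour on either side must have j = [66 ^+ 3], and then the two new neighbours
    agree. *)
Lemma not_attach_along_special v w : (vertex_j v = 0) \/ (vertex_j v = 1728) ->
  vertex_j w = vertex_j v -> new_neighbour_j v w -> ~ new_neighbour_j w v.
Proof.
have [E ->] := vertex_surj v; have [E' ->] := vertex_surj w.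
rewrite !vertex_j_of => s ej [x vx nx] [y wy ny].
have [e [E1 [q j1]]] := adjacent_quot vx; have [e' [E1' [q' j1']]] := adjacent_quot wy.
suff jxy : jinv E1 = jinv E1' by apply: (nx _ wy); rewrite -j1 -j1'.
case: s => [/eqP j0|/eqP j1728].
  have A0 := j0; have A0' := j0; rewrite -ej in A0'; rewrite !jinv_eq0 // in A0 A0'.
  by rewrite (jinv_quot_0 q (eqP A0)) (jinv_quot_0 q' (eqP A0')).
have B0 := j1728; have B0' := j1728; rewrite -ej in B0'.
rewrite !jinv_eq1728 // in B0 B0'; move/eqP in B0; move/eqP in B0'.
have self (C : ss_curve) : coefB C = 0 -> jinv C = 1728 ->
    exists2 z, adjacent (vertex_of C) z & vertex_j z = 1728.
  move=> C0 jC; have [|C' qC] := @quot_exists _ F2 C 0.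
    by rewrite C0; ring.
  have jC' : jinv C' = 1728.
    apply/eqP; rewrite jinv_eq1728 //; case: qC => _ _ ->.
    by apply/eqP; ring.
  have [C1 eC1] : exists C1 : ss_curve, ss_val C1 = C'.
    by apply: ss_exists; rewrite jC' -jC; exact: ss_vertex_j.
  exists (vertex_of C1); last by rewrite vertex_j_of eC1.
  by apply: (@quot_adjacent _ _ 0); rewrite eC1.
have [z wz jz] := self E' B0' (etrans ej (eqP j1728)).
have [z' vz jz'] := self E B0 (eqP j1728).
move: (jinv_quot_1728 q B0) (jinv_quot_1728 q' B0'); case: eqP => _ j.
  by case: (nx _ wz); rewrite jz -j1.
case: eqP => _ j'; first by case: (ny _ vz); rewrite jz' -j1'.
by rewrite j j'.
Qed.

End Graph.

(** * Twists of isogenies *)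

Section TwistMap.
Variables (k : fieldType) (d : k).
Hypothesis d0 : d != 0.
Implicit Types (E : curve k) (q : {poly k}).

Definition twist_arg : {poly k} := d^-1 *: 'X.

Lemma size_twist_arg : size twist_arg = 2.
Proof. by rewrite size_scale ?invr_neq0 // size_polyX. Qed.

Lemma horner_twist_arg x : twist_arg.[d * x] = x.
Proof. by rewrite hornerZ hornerX mulKf. Qed.

Lemma twist_monic q : q \is monic -> d ^+ (size q).-1 *: (q \Po twist_arg) \is monic.
Proof.
move=> /monicP mq; apply/monicP; rewrite lead_coefZ lead_coef_comp ?size_twist_arg //.
rewrite mq mul1r /twist_arg lead_coefZ lead_coefX mulr1 exprVn divff //.
exact: expf_neq0.
Qed.

(* (x, y) |-> (d X(x / d), y Y(x / d)), with denominators made monic. *)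
Definition twist_xymap (phi : xymap k) : xymap k :=
  XYMap ((d * d ^+ (size (xden phi)).-1) *: (xnum phi \Po twist_arg))
        (d ^+ (size (xden phi)).-1 *: (xden phi \Po twist_arg))
        (d ^+ (size (yden phi)).-1 *: (ynum phi \Po twist_arg))
        (d ^+ (size (yden phi)).-1 *: (yden phi \Po twist_arg)).

Lemma twist_isog_deg phi : isog_deg (twist_xymap phi) = isog_deg phi.
Proof.
by rewrite /isog_deg size_scale ?mulf_neq0 ?expf_neq0 // size_comp_poly2 // size_twist_arg.
Qed.

Lemma twist_isogeny E1 E2 Et1 Et2 phi :
  coefA Et1 = d ^+ 2 * coefA E1 -> coefB Et1 = d ^+ 3 * coefB E1 ->
  coefA Et2 = d ^+ 2 * coefA E2 -> coefB Et2 = d ^+ 3 * coefB E2 ->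
  isogeny E1 E2 phi -> isogeny Et1 Et2 (twist_xymap phi).
Proof.
case: phi => N D M L a1 b1 a2 b2 [[/= mD mL cND cML] sDN eqG].
have dn n : d ^+ n != 0 by exact: expf_neq0.
split=> /=.
- split=> /=; try exact: twist_monic.
    rewrite coprimepZl ?mulf_neq0 // coprimepZr // coprimep_comp_poly //.
  by rewrite coprimepZl // coprimepZr // coprimep_comp_poly.
- by rewrite !size_scale ?mulf_neq0 // !size_comp_poly2 ?size_twist_arg.
have := congr1 (fun q => q \Po twist_arg) eqG.
rewrite /cubic a1 b1 a2 b2 -!mul_polyC !exprS !expr0 !mulr1.
rewrite !(comp_polyD, comp_polyM, comp_polyC, comp_polyX).
move: (N \Po _) (D \Po _) (M \Po _) (L \Po _) => N' D' M' L'.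
have eX : 'X = d%:P * twist_arg.
  by rewrite /twist_arg mul_polyC scalerA divff // scale1r.
move=> h; rewrite {}eX; move: twist_arg h => T h.
move: (d ^+ _) (d ^+ _) => l m.
(* After substituting [x / d], both sides of the isogeny identity are multiplied by [d^3 m^3 l^2],
   where [m] and [l] make the denominators monic. *)
transitivity (d%:P ^+ 3 * m%:P ^+ 3 * l%:P ^+ 2 *
  (D' * (D' * D') * (M' * M') * (T * (T * T) + (coefA E1)%:P * T + (coefB E1)%:P))).
  ring.
rewrite h; ring.
Qed.

End TwistMap.

Section TwistEval.
Variable K : fieldType.

(** Over a field containing a square root [s] of [d], twisting is conjugation by the isomorphism of
    scale [s]. Relations between isogenies, being stated on points over [K], are thus preserved by
    twisting. *)
Lemma twist_eval (s d : K) phi P : s != 0 -> s ^+ 2 = d ->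
  eval_xymap (twist_xymap d phi) (scale_point s P) =
  scale_point s (eval_xymap phi P).
Proof.
move=> s0 <-; case: P => [[x y]|] //=.
have d0 : s ^+ 2 != 0 by exact: expf_neq0.
have dn n : (s ^+ 2) ^+ n != 0 by exact: expf_neq0.
rewrite !hornerZ !horner_comp horner_twist_arg // mulf_eq0 (negPf (dn _)) /=.
case: eqP => //= _; congr (Some (_, _)).
  by rewrite invfM mulrACA mulfK.
by rewrite -mulf_div divff // mul1r -mulrA.
Qed.

End TwistEval.

Lemma map_twist_xymap (k K : fieldType) (f : {rmorphism k -> K}) d phi :
  map_xymap f (twist_xymap d phi) = twist_xymap (f d) (map_xymap f phi).
Proof.
have e q : map_poly f (q \Po twist_arg d) = map_poly f q \Po twist_arg (f d).
  by rewrite map_comp_poly /twist_arg map_polyZ map_polyX fmorphV.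
by rewrite /twist_xymap /map_xymap /= !map_polyZ !e !size_map_poly /= rmorphM !rmorphXn.
Qed.

(** * Twisting as an involution of the graph *)

Section TwistGraph.
Variables (p : nat) (F : fieldType) (K : closedFieldType).
Variable iota : {rmorphism F -> K}.
Variable d : F.
Hypothesis d0 : d != 0.
Local Notation ss_curve := (ss_curve p iota).
Local Notation vertex := (vertex p iota).
Local Notation edge := (edge p iota).
Local Notation isogeny2 := (isogeny2 p iota).
Local Notation isog_equiv := (@isog_equiv p F K iota).
Implicit Types (E : ss_curve) (v w : vertex) (e : edge) (phi psi : isogeny2).

Lemma twist_nonsingular (E : curve F) :
  4 * (d ^+ 2 * coefA E) ^+ 3 + 27 * (d ^+ 3 * coefB E) ^+ 2 != 0.
Proof.
have -> : 4 * (d ^+ 2 * coefA E) ^+ 3 + 27 * (d ^+ 3 * coefB E) ^+ 2 =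
  d ^+ 6 * (4 * coefA E ^+ 3 + 27 * coefB E ^+ 2) by ring.
by rewrite mulf_neq0 ?curve_nonsingular ?expf_neq0.
Qed.

Definition twist_curve (E : curve F) : curve F := Curve (twist_nonsingular E).

Lemma twist_closed_iso : exists s : K, [/\ s != 0, s ^+ 2 = iota d &
  forall E : curve F, scale_iso s (map_curve iota E) (map_curve iota (twist_curve E))].
Proof.
have [s hs] := @closed_root_exp K 2 (iota d) isT.
have s0 : s != 0.
  have : s ^+ 2 != 0 by rewrite hs fmorph_eq0.
  by rewrite expf_eq0.
by exists s; split=> // E; split=> //=; rewrite rmorphM rmorphXn /= -hs -exprM.
Qed.

Lemma twist_supersingular E : supersingular p (map_curve iota (twist_curve E)).
Proof.
have [s [_ _ iso]] := twist_closed_iso.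
by apply: supersingular_scale (iso E) _; exact: ss_valP.
Qed.

Definition twist_ss E : ss_curve := SSCurve (@twist_supersingular E).

Lemma twist_scale_iso (w : F) E E' :
  scale_iso w E E' -> scale_iso w (twist_ss E) (twist_ss E').
Proof. by case=> w0 a b; split=> //=; rewrite ?a ?b; ring. Qed.

Lemma twist_twist_iso E : scale_iso d E (twist_ss (twist_ss E)).
Proof. by split=> //=; ring. Qed.

Lemma jinv_twist E : jinv (twist_ss E) = jinv E.
Proof.
apply: (fmorph_inj iota); rewrite -!map_jinv.
by have [s [_ _ iso]] := twist_closed_iso; exact: jinv_scale (iso E).
Qed.

Definition twist_isog phi : isogeny2 :=
  Isogeny2 (isog_src := twist_ss (isog_src phi)) (isog_tgt := twist_ss (isog_tgt phi))
    (@twist_isogeny _ _ d0 (isog_src phi) (isog_tgt phi) (twist_ss (isog_src phi))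
      (twist_ss (isog_tgt phi)) _ erefl erefl erefl erefl (isog_mapP phi))
    (etrans (twist_isog_deg d0 (isog_map phi)) (isog_map_deg phi)).

Lemma twist_isog_eval s phi P : s != 0 -> s ^+ 2 = iota d ->
  isog_eval (twist_isog phi) (scale_point s P) = scale_point s (isog_eval phi P).
Proof. by move=> s0 hs; rewrite /isog_eval map_twist_xymap (twist_eval _ _ s0 hs). Qed.

Lemma twist_isog_iso phi psi :
  isog_iso phi psi -> isog_iso (twist_isog phi) (twist_isog psi).
Proof.
case=> w [z [isow isoz ev]]; exists w, z; split; try exact: twist_scale_iso.
have [s [s0 hs iso]] := twist_closed_iso => P.
rewrite -(scale_pointK P s0) (on_curve_scale _ (iso _)) => onP.
by rewrite scale_pointC !(twist_isog_eval _ _ s0 hs) ev // scale_pointC.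
Qed.

Lemma twist_isog_dual phi psi :
  isog_dual phi psi -> isog_dual (twist_isog phi) (twist_isog psi).
Proof.
case=> st ts ev; split=> /=; rewrite ?st ?ts //.
have [s [s0 hs iso]] := twist_closed_iso => P.
rewrite -(scale_pointK P s0) (on_curve_scale _ (iso _)) => onP.
by rewrite !(twist_isog_eval _ _ s0 hs) ev // (addP_scale _ _ (iso _)).
Qed.

Lemma twist_isog_equiv phi psi :
  isog_equiv phi psi -> isog_equiv (twist_isog phi) (twist_isog psi).
Proof.
elim=> [{}phi {}psi []|{}phi|{}phi {}psi _|{}phi {}psi rho _ h _].
- by move/twist_isog_iso=> h; apply: rst_step; left.
- by move/twist_isog_dual=> h; apply: rst_step; right.
- exact: rst_refl.
- exact: rst_sym.
- exact: rst_trans.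
Qed.

Lemma twist_twist_isog phi : isog_equiv phi (twist_isog (twist_isog phi)).
Proof.
apply: rst_step; left; exists d, d; split; try exact: twist_twist_iso.
have [s [s0 hs iso]] := twist_closed_iso => P _.
by rewrite -hs expr2 !scale_pointM !(twist_isog_eval _ _ s0 hs).
Qed.

Lemma isog_class phi psi :
  class isog_equiv phi = class isog_equiv psi <-> isog_equiv phi psi.
Proof. by apply: classP; [exact: rst_refl | exact: rst_sym | exact: rst_trans]. Qed.

(** A representative is chosen; [twist_vertex_of] shows that the choice does not matter. *)
Definition twist_vertex v : vertex := vertex_of (twist_ss (sval (cid (vertex_surj v)))).

Definition twist_edge e : edge :=
  class isog_equiv (twist_isog (sval (cid (class_surj e)))).

Lemma twist_vertex_of E : twist_vertex (vertex_of E) = vertex_of (twist_ss E).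
Proof.
rewrite /twist_vertex; case: cid => E' /= /vertexP[w iso].
by apply/vertexP; exists w^-1; apply/scale_iso_sym/twist_scale_iso.
Qed.

Lemma twist_edge_class phi :
  twist_edge (class isog_equiv phi) = class isog_equiv (twist_isog phi).
Proof.
rewrite /twist_edge; case: cid => psi /= /isog_class h.
by apply/isog_class/rst_sym/twist_isog_equiv.
Qed.

Lemma twist_vertexK v : twist_vertex (twist_vertex v) = v.
Proof.
have [E ->] := vertex_surj v; rewrite !twist_vertex_of; apply/esym/vertexP.
by exists d; exact: twist_twist_iso.
Qed.

Lemma twist_edgeK e : twist_edge (twist_edge e) = e.
Proof.
have [phi ->] := class_surj e; rewrite !twist_edge_class.
by apply/esym/isog_class/twist_twist_isog.
Qed.

Lemma twist_vertex_j v : vertex_j (twist_vertex v) = vertex_j v.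
Proof.
by have [E ->] := vertex_surj v; rewrite twist_vertex_of !vertex_j_of jinv_twist.
Qed.

Lemma twist_joins e v w :
  joins e v w -> joins (twist_edge e) (twist_vertex v) (twist_vertex w).
Proof.
case=> phi /members_edge -> h; rewrite twist_edge_class.
exists (twist_isog phi); first exact: rst_refl.
rewrite !members_vertex in h *.
by case: h => -[-> ->]; [left | right]; rewrite !twist_vertex_of.
Qed.

Lemma twist_joinsE e v w :
  joins e v w <-> joins (twist_edge e) (twist_vertex v) (twist_vertex w).
Proof.
split; first exact: twist_joins.
by move/twist_joins; rewrite twist_edgeK !twist_vertexK.
Qed.

Lemma twist_adjacent v w : adjacent v w -> adjacent (twist_vertex v) (twist_vertex w).
Proof. by case=> e h; exists (twist_edge e); exact: twist_joins. Qed.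

Local Notation connected := (clos_refl_trans vertex (@adjacent p F K iota)).

Lemma twist_connected v w : connected v w ->
  connected (twist_vertex v) (twist_vertex w).
Proof.
elim=> [{}v {}w h|{}v|{}v {}w x _ h _ h'].
- by apply: rt_step; exact: twist_adjacent.
- exact: rt_refl.
- exact: rt_trans h h'.
Qed.

Lemma twist_connectedE v w : connected (twist_vertex v) w <-> connected v (twist_vertex w).
Proof.
by split=> /twist_connected; rewrite twist_vertexK.
Qed.

Lemma component_twist (V : set vertex) : component V ->
  (exists2 W : set vertex, component W & stack V W) \/
  (forall v, V v -> V (twist_vertex v)).
Proof.
case=> v0 eV; pose W := [set w | connected (twist_vertex v0) w].
(* Since twisting is an involution, [W] is both the image and the preimage of [V]. *)
have VW v : W v <-> V (twist_vertex v) by rewrite eV /W /= twist_connectedE.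
have [eW|nW] := pselect (W = V).
  by right=> v; rewrite -VW eW.
left; exists W; first by exists (twist_vertex v0).
split; first by move=> e; apply: nW.
have VW' v : V v <-> W (twist_vertex v) by rewrite VW twist_vertexK.
exists twist_vertex, twist_edge; split.
- split; first by move=> v; rewrite VW'.
    by move=> v w _ _; exact: can_inj twist_vertexK v w.
  by move=> w /VW Vw; exists (twist_vertex w); rewrite ?twist_vertexK.
- by move=> v _; exact: twist_vertex_j.
- split.
  + move=> e [v [w [Vv Vw h]]]; exists (twist_vertex v), (twist_vertex w).
    by split; [exact/VW' | exact/VW' | exact: twist_joins].
  + by move=> e e' _ _; exact: can_inj twist_edgeK e e'.
  + move=> e [v [w [Wv Ww h]]]; exists (twist_edge e); last exact: twist_edgeK.
    exists (twist_vertex v), (twist_vertex w).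
    by split; [exact/VW | exact/VW | exact: twist_joins].
- by move=> e v w _ _ _; exact: twist_joinsE.
Qed.

End TwistGraph.

(** * Squares in a finite field *)

Section FiniteField.
Variable F : finFieldType.

(** Otherwise a choice of square roots would be injective, hence bijective by finiteness, and
    squaring would be its inverse; but 1 and -1 have the same square. *)
Lemma nonsquare_exists : (2 : F) != 0 -> exists d : F, ~ exists c, c ^+ 2 = d.
Proof.
move=> F2; apply: contrapT => /forallNP h.
have /choice[g hg] : forall d : F, exists c, c ^+ 2 = d by move=> d; exact: contrapT.
have gi : injective g by move=> x y e; rewrite -[x]hg e hg.
have [f _ fK] := injF_bij gi.
have e : f 1 = f (- 1) by rewrite -[LHS]hg -[RHS]hg !fK sqrrN.
have := congr1 g e; rewrite !fK => /eqP; rewrite -subr_eq0 opprK.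
by rewrite -[1 + 1]/(2 : F) (negPf F2).
Qed.

(** The nonsquares are odd powers of a generator of the cyclic unit group. *)
Lemma nonsquare_mul (d d' : F) :
  (~ exists c, c ^+ 2 = d) -> (~ exists c, c ^+ 2 = d') -> exists c, c ^+ 2 = d * d'.
Proof.
move=> nd nd'; have /cyclicP[g hg] := field_unit_group_cyclic [set: {unit F}]%G.
have pow (x : F) : (~ exists c, c ^+ 2 = x) -> exists n, x = FinRing.uval g ^+ n.*2.+1.
  move=> nx; have x0 : x != 0.
    by apply: contra_notN nx => /eqP ->; exists 0; rewrite expr0n.
  have /cycleP[n hn] : finField_unit x0 \in <[g]>%g by rewrite -hg inE.
  have ex : x = FinRing.uval g ^+ n by rewrite -FinRing.val_unitX -hn.
  exists n./2; rewrite ex -[n in LHS]odd_double_half; case: (boolP (odd n)) => // ev.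
  case: nx; exists (FinRing.uval g ^+ n./2).
  by rewrite ex -exprM muln2 -[n in RHS]odd_double_half (negPf ev).
have [m ->] := pow d nd; have [n ->] := pow d' nd'.
exists (FinRing.uval g ^+ (m + n).+1).
by rewrite -exprM -exprD; congr (_ ^+ _); rewrite muln2 doubleS doubleD addSn addnS.
Qed.

(** Twists by two nonsquares [d] and [r] are isomorphic, because [r / d] is the square of [c / d].
    So twisting by one fixed [d] accounts for every quadratic twist. *)
Lemma twist_related (d r : F) (E E' : curve F) (d0 : d != 0) :
  (~ exists c, c ^+ 2 = d) -> (~ exists c, c ^+ 2 = r) ->
  coefA E' = r ^+ 2 * coefA E -> coefB E' = r ^+ 3 * coefB E ->
  exists w, scale_iso w (twist_curve d0 E) E'.
Proof.
move=> nd nr a b; have [c hc] := nonsquare_mul nd nr.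
have r0 : r != 0.
  by apply: contra_notN nr => /eqP ->; exists 0; rewrite expr0n.
have er : r = c ^+ 2 / d by rewrite hc mulrC mulKf.
have c0 : c != 0 by apply: contra_neq r0; rewrite er => ->; rewrite expr0n mul0r.
exists (c / d); split; first by rewrite mulf_neq0 ?invr_neq0.
  by rewrite a er /=; field; exact: d0.
by rewrite b er /=; field; exact: d0.
Qed.

End FiniteField.

(** * Stacking, folding, and the discriminant of a new edge *)

Section PrimeField.
Variables (p : nat) (F : finFieldType) (K : closedFieldType).
Variable iota : {rmorphism F -> K}.
Hypotheses (F2 : (2 : F) != 0) (F3 : (3 : F) != 0).

Let K2 : (2 : K) != 0. Proof. by rewrite -(rmorph_nat iota) fmorph_eq0. Qed.
Let K3 : (3 : K) != 0. Proof. by rewrite -(rmorph_nat iota) fmorph_eq0. Qed.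

Lemma component_stack_or_fold (V : set (vertex p iota)) : component V ->
  (exists2 W : set (vertex p iota), component W & stack V W) \/ folds V.
Proof.
have [d nd] := nonsquare_exists F2.
have d0 : d != 0.
  by apply: contra_notN nd => /eqP ->; exists 0; rewrite expr0n.
case/(component_twist d0) => [st|tw]; [by left | right=> E E' VE [r [nr a b]]].
have := tw _ VE; rewrite twist_vertex_of.
suff -> : vertex_of (twist_ss d0 E) = vertex_of E' by [].
by apply/vertexP; exact: (twist_related d0 nd nr a b).
Qed.

Lemma not_attach_along (V W : set (vertex p iota)) (a : F) : ~ attach_along V W a.
Proof.
move=> [_ [v [w [[_ jv] [_ jw] nv nw]]]].
have ns : forall z : F, vertex_j v = z -> (z = 0 \/ z = 1728) -> False.
  by move=> z <- h; apply: not_attach_along_special nv nw; rewrite ?jw.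
have [E ev] := vertex_surj v; have [E' ew] := vertex_surj w; subst v w.
rewrite !vertex_j_of in jv jw ns.
have A0 : coefA E != 0.
  by rewrite -jinv_eq0 //; apply/eqP => h; apply: (ns _ erefl); left.
have B0 : coefB E != 0.
  by rewrite -jinv_eq1728 //; apply/eqP => h; apply: (ns _ erefl); right.
have [r r0 [a' b']] := jinv_eq_twist F2 F3 (etrans jv (esym jw)) A0 B0.
have [d nd] := nonsquare_exists F2.
have d0 : d != 0.
  by apply: contra_notN nd => /eqP ->; exists 0; rewrite expr0n.
case: nv => x vx nx; have [[c hc]|nr] := pselect (exists c, c ^+ 2 = r).
  have ee : vertex_of E = vertex_of E'.
    apply/vertexP; exists c; split; rewrite ?a' ?b' -?hc -?exprM //.
    by move: r0; rewrite -hc expf_eq0.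
  by apply: (nx x) => //; rewrite -ee.
have ee : twist_vertex d0 (vertex_of E) = vertex_of E'.
  by rewrite twist_vertex_of; apply/vertexP; exact: (twist_related d0 nd nr a' b').
apply: (nx (twist_vertex d0 x)); last exact: twist_vertex_j.
by rewrite -ee; exact: twist_adjacent.
Qed.

(** Any model [C] with j-invariant [a] is allowed, not only the source of the attaching isogeny; at
    0 and 1728 a more convenient model is used. *)
Lemma new_edge_not_rational (a b e : F) (C C' : curve F) :
  new_edge p iota a b -> jinv C = a -> quot_by C e C' -> jinv C' <> b.
Proof.
move=> [_ [sa sb _] nadj] ja q jb; apply: nadj.
have [E eE] : exists E : ss_curve p iota, ss_val E = C by apply: ss_exists; rewrite ?ja.
have [E' eE'] : exists E : ss_curve p iota, ss_val E = C' by apply: ss_exists; rewrite ?jb.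
exists (vertex_of E), (vertex_of E'); rewrite !vertex_j_of eE eE'; split=> //.
by apply: (@quot_adjacent _ _ _ _ _ _ e); rewrite eE eE'.
Qed.

Hypotheses (card_F : #|F| = p) (pchar_F : p \in [pchar F]).

Lemma pchar_closure : p \in [pchar K].
Proof. by apply: (rmorph_pchar iota). Qed.

(** [X^p - X] is already a product of linear factors over [F], so all its roots in [K] come from
    [F]. *)
Lemma frobenius_fixed (e : K) : e ^+ p = e -> exists x, e = iota x.
Proof.
move=> h; have : (map_poly iota ('X^p - 'X)).[e] = 0.
  by rewrite rmorphB /= map_polyXn map_polyX !hornerE h subrr.
have -> : 'X^p - 'X = \prod_x ('X - x%:P) :> {poly F}.
  by rewrite -finField_genPoly card_F.
rewrite rmorph_prod horner_prod /=.
move/eqP/prodf_eq0 => [x _]; rewrite map_polyXsubC hornerXsubC subr_eq0 => /eqP ->.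
by exists x.
Qed.

Lemma new_edge_discriminant (V W : set (vertex p iota)) (a b : F) :
  attached_by_new_edge V W a b ->
  a ^+ 2 + 225 * 849 * a - 495 ^+ 3 = 0 /\ b = - (a + 225 * 849).
Proof.
move=> [new [E [E' [phi [[_ ja] [_ jb] [iso deg] _]]]]].
have ab : a <> b by case: new.
have [e [E1 [u [q isoE1]]]] := isogeny2_quot K2 K3 iso deg.
have j1 : jinv E1 = iota b by rewrite -(jinv_scale isoE1) map_jinv jb.
have jE : jinv (map_curve iota E) = iota a by rewrite map_jinv ja.
have eK : e ^+ p != e.
  apply/eqP=> /frobenius_fixed[x ex]; subst e.
  have [re _ _] := q; have [|C qC] := @quot_exists _ F2 E x.
    by apply: (fmorph_inj iota); rewrite rmorph0 -[RHS]re /=; ring.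
  apply: (new_edge_not_rational new ja qC); apply: (fmorph_inj iota).
  by rewrite -map_jinv -j1 (quot_unique (map_quot_by iota qC) q).
pose frob := pFrobenius_aut pchar_closure.
have frobF x : frob (iota x) = iota x.
  by rewrite /frob pFrobenius_autE -rmorphXn /= -[X in _ ^+ X]card_F expf_card.
have q2 := map_quot_by frob q.
have eE : map_curve frob (map_curve iota E) = map_curve iota E.
  by apply: curve_eq; exact: frobF.
rewrite eE in q2.
(* Frobenius fixes [E] and the image of [b], so the conjugate quotient of [E] has the same
   j-invariant. *)
have j2 : jinv E1 = jinv (map_curve frob E1) by rewrite map_jinv j1; apply/esym/frobF.
have [] := double_edge K2 K3 _ q q2 j2; first by rewrite eq_sym.
- move=> A0; have a0 : a = 0.
    by apply/eqP; rewrite -ja jinv_eq0 // -(fmorph_eq0 iota); apply/eqP.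
  (* The model [y^2 = x^3 - 1] has the rational point [(1, 0)], and at j = 0 all quotients have the
     same j-invariant. *)
  have n0 : 4 * 0 ^+ 3 + 27 * (- 1) ^+ 2 != 0 :> F.
    by rewrite sqrrN expr1n expr0n mulr0 add0r mulr1 (natr23_neq0 F2 F3 0 3).
  have [|C qC] := @quot_exists _ F2 (Curve n0) 1; first by rewrite /=; ring.
  case: (new_edge_not_rational new _ qC).
    by apply/eqP; rewrite a0 jinv_eq0.
  apply: (fmorph_inj iota); rewrite -j1 (jinv_quot_0 K2 K3 q A0).
  by rewrite (jinv_quot_0 F2 F3 qC) //; ring.
- move=> B0; have a1728 : a = 1728.
    apply/eqP; rewrite -ja jinv_eq1728 // -(fmorph_eq0 iota); exact/eqP.
  (* The model [y^2 = x^3 - x] has the rational point [(1, 0)], whose quotient has j = [66 ^+ 3]. If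
     [e = 0] instead, then [b = 1728 = a], which is excluded. *)
  have n0 : 4 * (- 1) ^+ 3 + 27 * 0 ^+ 2 != 0 :> F.
    have -> : 4 * (- 1) ^+ 3 + 27 * 0 ^+ 2 = - 2 ^+ 2 :> F by ring.
    by rewrite oppr_eq0 expf_neq0.
  have [|C qC] := @quot_exists _ F2 (Curve n0) 1; first by rewrite /=; ring.
  case: (new_edge_not_rational new _ qC).
    by apply/eqP; rewrite a1728 jinv_eq1728.
  apply: (fmorph_inj iota); rewrite -j1 (jinv_quot_1728 K2 K3 q B0).
  rewrite (jinv_quot_1728 F2 F3 qC) // oner_eq0; case: eqP => e0; last by ring.
  case: ab; apply: (fmorph_inj iota).
  by rewrite -j1 (jinv_quot_1728 K2 K3 q B0) e0 eqxx a1728; ring.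
- by rewrite j1 jE => /(fmorph_inj iota)/esym.
- rewrite j1 jE => -[h1 h2]; split; apply: (fmorph_inj iota).
    by rewrite rmorph0 -[RHS]h1; ring.
  by rewrite h2; ring.
Qed.

End PrimeField.

(** * The field with [p] elements *)

Lemma Fp_nat_neq0 p n : prime p -> (0 < n < p)%N -> (n%:R : 'F_p) != 0.
Proof.
move=> p_prime /andP[n0 np]; rewrite -(dvdn_pcharf (pchar_Fp p_prime)).
by apply: contraL np => /(dvdn_leq n0); rewrite -leqNgt.
Qed.

Theorem theorem3p26 (p : nat) (K : closedFieldType)
    (iota : {rmorphism 'F_p -> K})
    (p_prime : prime p) (p_gt3 : (3 < p)%N)
    (K_algebraic : integralRange iota) :
  [/\ forall V : set (vertex p iota), component V ->
        (exists2 W : set (vertex p iota), component W & stack V W) \/ folds V,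
      forall a b c d : 'F_p,
        (exists V W : set (vertex p iota),
           [/\ component V, component W & attached_by_new_edge V W a b]) ->
        (exists V W : set (vertex p iota),
           [/\ component V, component W & attached_by_new_edge V W c d]) ->
        (c = a /\ d = b) \/ (c = b /\ d = a)
    & forall (V W : set (vertex p iota)) (a : 'F_p),
        component V -> component W -> ~ attach_along V W a].
Proof.
have F2 : (2 : 'F_p) != 0 by apply: Fp_nat_neq0 => //; exact: ltnW.
have F3 : (3 : 'F_p) != 0 by exact: Fp_nat_neq0.
have disc := new_edge_discriminant F2 F3 (card_Fp p_prime) (pchar_Fp p_prime).
split.
- exact: component_stack_or_fold F2.
- move=> a b c d [V [W [_ _ /disc[ha ->]]]] [V' [W' [_ _ /disc[hc ->]]]].
  (* [a] and [c] are roots of one quadratic polynomial, whose roots sum to [- 225 * 849]. *)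
  have : (c - a) * (c + (a + 225 * 849)) = 0.
    by rewrite -[RHS](subrr 0) -{1}hc -ha; ring.
  move/eqP; rewrite mulf_eq0 subr_eq0 addr_eq0 => /orP[] /eqP ->.
    by left.
  by right; split=> //; ring.
- by move=> V W a _ _; exact: not_attach_along F2 F3 _ _ _.
Qed.
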